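(* Let $A$ be an indecomposable and indefinite $n\times n$ Cartan matrix. If $A$ is symmetrizable, then $I(A)=\mathbb{Q}[\psi]$, where $\psi$ is a non-zero element of $I^2(A)$ (the invariant symmetric bilinear form, unique up to a constant). If $A$ is not symmetrizable, then $I(A)=\mathbb{Q}$.
   Context: A Cartan matrix is an $n\times n$ integer matrix $A=(a_{ij})$ with $a_{ii}=2$, $a_{ij}\le 0$ for $i\ne j$, and $a_{ij}=0\Rightarrow a_{ji}=0$. It is indecomposable if it is not, after a simultaneous permutation of rows and columns, a direct sum of two smaller Cartan matrices. It is of finite type if all its principal minors are positive, of affine type if all its principal minors are non-negative and it has rank $n-1$, and of indefinite type otherwise. It is symmetrizable if $A=DB$ with $D$ an invertible diagonal matrix and $B$ a symmetric matrix. Let $h$ be the real vector space with basis the simple coroots $\alpha_1^\vee,\dots,\alpha_n^\vee$, let $\omega_1,\dots,\omega_n$ be the dual basis of $h^*$, and let $\alpha_i=\sum_{j=1}^n a_{ji}\omega_j\in h^*$. The Weyl group $W(A)$ is the group generated by $\sigma_i:h^*\to h^*$, $\sigma_i(\alpha)=\alpha-\langle\alpha,\alpha_i^\vee\rangle\alpha_i$, $1\le i\le n$; thus $\sigma_i(\omega_j)=\omega_j-\delta_{ij}\alpha_i$. It acts by ring automorphisms on $\mathbb{Q}[\omega_1,\dots,\omega_n]$. $I(A)$ is the ring of $W(A)$-invariant polynomials in $\mathbb{Q}[\omega_1,\dots,\omega_n]$, graded by polynomial degree, $I(A)=\bigoplus_{i\ge0}I^i(A)$. *)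

(* Defs.v *)
From HB Require Import structures.
From mathcomp Require Import all_boot all_order all_algebra all_fingroup.
From mathcomp Require Export ssrcomplements mpoly.

Set Implicit Arguments.
Unset Strict Implicit.
Unset Printing Implicit Defensive.

Import Order.TTheory GRing.Theory Num.Theory.
Local Open Scope ring_scope.

Definition cartan_matrix n (A : 'M[int]_n) : Prop :=
  [/\ forall i, A i i = 2,
      forall i j, i != j -> A i j <= 0 &
      forall i j, A i j = 0 -> A j i = 0].

Definition decomposable n (A : 'M[int]_n) : Prop :=
  exists n1 n2 (e : (n1 + n2)%N = n) (s : 'S_n) (A1 : 'M[int]_n1) (A2 : 'M[int]_n2),
    [/\ (n1 < n)%N, (n2 < n)%N, cartan_matrix A1, cartan_matrix A2 &
        row_perm s (col_perm s A) = castmx (e, e) (block_mx A1 0 0 A2)].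

Definition indecomposable n (A : 'M[int]_n) : Prop := ~ decomposable A.

Definition principal_minor n (A : 'M[int]_n) (S : {set 'I_n}) : int :=
  \det (mxsub (@enum_val _ (mem S)) (@enum_val _ (mem S)) A).

(* The minor attached to the empty set is 1, so it is harmless below. *)
Definition finite_type n (A : 'M[int]_n) : Prop :=
  forall S : {set 'I_n}, 0 < principal_minor A S.

Definition affine_type n (A : 'M[int]_n) : Prop :=
  (forall S : {set 'I_n}, 0 <= principal_minor A S) /\
  \rank (map_mx (intr : int -> rat) A) = n.-1.

Definition indefinite_type n (A : 'M[int]_n) : Prop :=
  ~ finite_type A /\ ~ affine_type A.

Definition symmetrizable n (A : 'M[int]_n) : Prop :=
  exists D B : 'M[rat]_n,
    [/\ is_diag_mx D, D \in unitmx, B^T = B & map_mx intr A = D *m B].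

(* Coordinates: h is the space of column vectors in the basis of simple
   coroots, and h^* the space of row vectors in the dual basis omega_i, so that
   the pairing is lambda *m x and <lambda, alpha_i^vee> = lambda 0 i.  Linear
   endomorphisms of h^* are matrices acting on the right of row vectors.  The
   field of scalars F is left free: W(A) is the same group over any extension
   of the rationals (lemma weyl_ratr), and it is its rational form that acts on
   rat[omega_1, ..., omega_n]. *)
Section WeylGroup.
Variables (F : fieldType) (n : nat) (A : 'M[int]_n).

Definition simple_root (i : 'I_n) : 'rV[F]_n := \row_j (A j i)%:~R.

Definition reflection (i : 'I_n) (v : 'rV[F]_n) : 'rV[F]_n :=
  v - v 0 i *: simple_root i.

Inductive weyl : 'M[F]_n -> Prop :=
| weyl1 : weyl 1%:M
| weyl_reflection i : weyl (lin1_mx (reflection i))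
| weylM w1 w2 : weyl w1 -> weyl w2 -> weyl (w1 *m w2)
| weylV w : weyl w -> weyl (invmx w).

Lemma reflection_is_linear i : linear (reflection i).
Proof.
move=> a u v; rewrite /reflection !mxE scalerDl scalerBr scalerA opprD.
by rewrite addrACA.
Qed.

Lemma mul_reflection_mx i v : v *m lin1_mx (reflection i) = reflection i v.
Proof.
pose L := GRing.isLinear.Build _ _ _ _ (reflection i) (@reflection_is_linear i).
pose f : {linear 'rV[F]_n -> 'rV[F]_n} := HB.pack (reflection i) L.
exact: (mul_rV_lin1 f).
Qed.

End WeylGroup.

Lemma weyl_ratr (R : numFieldType) n (A : 'M[int]_n) (w : 'M[R]_n) :
  weyl A w <-> exists2 w0 : 'M[rat]_n, weyl A w0 & w = map_mx ratr w0.
Proof.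
have refl i : lin1_mx (reflection A i) =
    map_mx ratr (lin1_mx (reflection A i)) :> 'M[R]_n.
  apply/matrixP=> j k.
  by rewrite !mxE !eqxx /= rmorphB rmorphM /= !ratr_nat ratr_int.
split.
  elim=> [|i|w1 w2 _ [u1 h1 ->] _ [u2 h2 ->]|w1 _ [u1 h1 ->]].
  - by exists 1%:M; [exact: weyl1 | rewrite map_mx1].
  - by exists (lin1_mx (reflection A i)); [exact: weyl_reflection|].
  - by exists (u1 *m u2); [exact: weylM | rewrite map_mxM].
  - by exists (invmx u1); [exact: weylV | rewrite map_invmx].
case=> w0 h0 ->; elim: {w0} h0 => [|i|w1 w2 _ h1 _ h2|w1 _ h1].
- by rewrite map_mx1; exact: weyl1.
- by rewrite -refl; exact: weyl_reflection.
- by rewrite map_mxM; exact: weylM.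
- by rewrite map_invmx; exact: weylV.
Qed.

(* 'X_i stands for omega_i; w sends omega_i to row i of w. *)
Definition poly_act n (w : 'M[rat]_n) (f : {mpoly rat[n]}) : {mpoly rat[n]} :=
  f \mPo [tuple \sum_(j < n) w i j *: 'X_j | i < n].

Definition inv_ring n (A : 'M[int]_n) (f : {mpoly rat[n]}) : Prop :=
  forall w : 'M[rat]_n, weyl A w -> poly_act w f = f.

Definition inv_ring_deg n (A : 'M[int]_n) (d : nat) (f : {mpoly rat[n]}) : Prop :=
  inv_ring A f /\ f \is d.-homog.

Definition coroot_act n (w : 'M[rat]_n) (x : 'cV[rat]_n) : 'cV[rat]_n :=
  invmx w *m x.

Definition bilin n (B : 'M[rat]_n) (x y : 'cV[rat]_n) : rat :=
  (x^T *m B *m y) 0 0.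

Definition invariant_symmetric_form n (A : 'M[int]_n) (B : 'M[rat]_n) : Prop :=
  (forall x y, bilin B x y = bilin B y x) /\
  (forall w, weyl A w ->
     forall x y, bilin B (coroot_act w x) (coroot_act w y) = bilin B x y).

(* The polynomial function x |-> bilin B x x on h. *)
Definition form_poly n (B : 'M[rat]_n) : {mpoly rat[n]} :=
  \sum_(i < n) \sum_(j < n) B i j *: ('X_i * 'X_j).

(* Main.v *)
(* Let f be a nonzero invariant, homogeneous of degree d > 0, and write D_x for
   the derivative along x in h.  For real roots b, c with coroots x, y, the
   polynomial b(y) c D_x f - c(x) b D_y f changes sign under both reflections.
   If they generate an infinite dihedral group, it vanishes on infinitely many
   hyperplanes through a common subspace of codimension 2, hence is 0, and
   D_x f / b is proportional to D_y f / c; call b and c related.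

   The pairings of roots with simple coroots are unbounded: otherwise there are
   finitely many real roots c, and the form sum_c c(x) c(y) is invariant,
   positive semidefinite with kernel of dimension at most 1, which makes A
   finite or affine.  Hence some simple root is related to a root with which it
   generates a hyperbolic dihedral group.  This relation propagates through the
   connected diagram, so that all simple roots are related: the partial
   derivatives of f are D_i f = c_i alpha_i h for a single h, with c_i <> 0.
   By Euler's formula d f = h q with q = sum_i c_i omega_i alpha_i; here h and q
   are invariant, and the diagonal coefficients of q are nonzero.  So A is
   symmetrizable, q is a multiple of psi, and induction applies to h. *)
From HB Require Import structures.
Require Import Defs.
From mathcomp Require Import all_boot all_order all_algebra.
From mathcomp Require Import ring lra zify.
From mathcomp Require Import perm boolp.
Set Implicit Arguments.
Unset Strict Implicit.
Unset Printing Implicit Defensive.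
Import Order.TTheory GRing.Theory Num.Theory.
Local Open Scope ring_scope.

(** * Reflections and polynomial functions *)

Lemma subr_scaler2 (R : pzRingType) (V : lmodType R) (v : V) : v - 2 *: v = - v.
Proof. by rewrite scaler_nat mulr2n opprD addrA subrr sub0r. Qed.

Section Pairing.
Variables (R : comNzRingType) (n : nat).
Implicit Types (l : 'rV[R]_n) (x : 'cV[R]_n).

Definition pairing l x : R := (l *m x) 0 0.

(** When [pairing l x] is 2, one matrix serves both spaces: it reflects rows when multiplied on
    their right and columns when multiplied on their left. *)
Definition srefl l x : 'M[R]_n := 1%:M - x *m l.

Lemma mul_rV_srefl l b x : l *m srefl b x = l - pairing l x *: b.
Proof.
rewrite /srefl mulmxBr mulmx1 mulmxA; congr (_ - _).
by rewrite [l *m x]mx11_scalar mul_scalar_mx.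
Qed.

Lemma mul_srefl_cV b x y : srefl b x *m y = y - pairing b y *: x.
Proof.
rewrite /srefl mulmxBl mul1mx -mulmxA; congr (_ - _).
by rewrite [b *m y]mx11_scalar mul_mx_scalar.
Qed.

Lemma pairingBl l1 l2 x : pairing (l1 - l2) x = pairing l1 x - pairing l2 x.
Proof. by rewrite /pairing mulmxBl !mxE. Qed.

Lemma pairingZl a l x : pairing (a *: l) x = a * pairing l x.
Proof. by rewrite /pairing -scalemxAl mxE. Qed.

Lemma pairingDr l x1 x2 : pairing l (x1 + x2) = pairing l x1 + pairing l x2.
Proof. by rewrite /pairing mulmxDr mxE. Qed.

Lemma pairingBr l x1 x2 : pairing l (x1 - x2) = pairing l x1 - pairing l x2.
Proof. by rewrite /pairing mulmxBr !mxE. Qed.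

Lemma pairingZr a l x : pairing l (a *: x) = a * pairing l x.
Proof. by rewrite /pairing -scalemxAr mxE. Qed.

Lemma pairing_mulmx l (w : 'M_n) x : pairing (l *m w) x = pairing l (w *m x).
Proof. by rewrite /pairing mulmxA. Qed.

Lemma pairing_delta l i : pairing l (delta_mx i 0) = l 0 i.
Proof. by rewrite /pairing -colE mxE. Qed.

Lemma pairingE l x : pairing l x = \sum_i l 0 i * x i 0.
Proof. by rewrite /pairing mxE. Qed.

Lemma sreflK l x : pairing l x = 2 -> srefl l x *m srefl l x = 1%:M.
Proof.
move=> h; rewrite {2}/srefl mulmxBr mulmx1 mulmxA mul_srefl_cV h.
by rewrite subr_scaler2 mulNmx opprK /srefl subrK.
Qed.

End Pairing.

Lemma map_srefl (R S : comNzRingType) (f : {rmorphism R -> S}) n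
    (l : 'rV[R]_n) (x : 'cV[R]_n) :
  map_mx f (srefl l x) = srefl (map_mx f l) (map_mx f x).
Proof. by rewrite /srefl map_mxB map_mx1 map_mxM. Qed.

Lemma map_pairing (R S : comNzRingType) (f : {rmorphism R -> S}) n
    (l : 'rV[R]_n) (x : 'cV[R]_n) :
  pairing (map_mx f l) (map_mx f x) = f (pairing l x).
Proof. by rewrite /pairing -map_mxM mxE. Qed.

(** * Linear substitutions and directional derivatives *)

Section PolyCalculus.
Variable n : nat.
Implicit Types (l : 'rV[rat]_n) (x : 'cV[rat]_n) (w : 'M[rat]_n).
Implicit Types (f g : {mpoly rat[n]}).

Definition lin l : {mpoly rat[n]} := \sum_j l 0 j *: 'X_j.

Definition dirder x f : {mpoly rat[n]} := \sum_j x j 0 *: f^`M(j).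

Definition ev f x : rat := f.@[fun i => x i 0].

Lemma lin_is_linear : linear lin.
Proof.
move=> a u v; rewrite /lin scaler_sumr -big_split /=; apply: eq_bigr => j _.
by rewrite !mxE scalerDl scalerA.
Qed.

HB.instance Definition _ := GRing.isLinear.Build _ _ _ _ lin lin_is_linear.

Lemma linB u v : lin (u - v) = lin u - lin v.
Proof. exact: raddfB. Qed.

Lemma linN u : lin (- u) = - lin u.
Proof. exact: raddfN. Qed.

Lemma linZ a u : lin (a *: u) = a *: lin u.
Proof. exact: linearZ. Qed.

Lemma lin_delta i : lin (delta_mx 0 i) = 'X_i.
Proof.
rewrite /lin (bigD1 i) //= mxE !eqxx scale1r big1 ?addr0 // => j hj.
by rewrite mxE (negPf hj) andbF scale0r.
Qed.

Lemma ev_lin l x : ev (lin l) x = pairing l x.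
Proof.
rewrite /ev /lin raddf_sum pairingE /=; apply: eq_bigr => i _.
by rewrite mevalZ mevalXU.
Qed.

Lemma lin_eq0 l : (lin l == 0) = (l == 0).
Proof.
apply/eqP/eqP=> [h|->]; last exact: raddf0.
apply/rowP=> i; rewrite mxE -(pairing_delta l i) -ev_lin h /ev.
by rewrite meval0.
Qed.

Lemma dirder_linearl f : linear (dirder^~ f).
Proof.
move=> a u v; rewrite /dirder scaler_sumr -big_split /=; apply: eq_bigr => j _.
by rewrite !mxE scalerDl scalerA.
Qed.

Lemma dirder_is_linear x : linear (dirder x).
Proof.
move=> a f g; rewrite /dirder scaler_sumr -big_split /=; apply: eq_bigr => j _.
by rewrite mderivD mderivZ scalerDr !scalerA mulrC.
Qed.

HB.instance Definition _ x :=
  GRing.isLinear.Build _ _ _ _ (dirder x) (dirder_is_linear x).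

Lemma dirderDl x y f : dirder (x + y) f = dirder x f + dirder y f.
Proof. by have := dirder_linearl f 1 x y; rewrite !scale1r. Qed.

Lemma dirderZl a x f : dirder (a *: x) f = a *: dirder x f.
Proof.
by rewrite /dirder scaler_sumr; apply: eq_bigr => i _; rewrite mxE scalerA.
Qed.

Lemma dirderNl x f : dirder (- x) f = - dirder x f.
Proof. by rewrite -scaleN1r dirderZl scaleN1r. Qed.

Lemma dirder_delta i f : dirder (delta_mx i 0) f = f^`M(i).
Proof.
rewrite /dirder (bigD1 i) //= mxE !eqxx scale1r big1 ?addr0 // => j hj.
by rewrite mxE (negPf hj) scale0r.
Qed.

Lemma dirderM x f g : dirder x (f * g) = dirder x f * g + f * dirder x g.
Proof.
rewrite /dirder mulr_suml mulr_sumr -big_split /=; apply: eq_bigr => i _.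
by rewrite mderivM scalerDr scalerAl scalerAr.
Qed.

Lemma dirderC x c : dirder x c%:MP = 0.
Proof. by rewrite /dirder big1 // => i _; rewrite mderivC scaler0. Qed.

Lemma dirder_lin x l : dirder x (lin l) = (pairing l x)%:MP.
Proof.
rewrite /dirder pairingE (raddf_sum (@mpolyC n rat)); apply: eq_bigr => i _.
rewrite /lin (raddf_sum (mderiv i)) (bigD1 i) //= big1 => [|j hj].
  rewrite addr0 mderivZ mderivX mnmE eqxx.
  have -> : (U_(i) - U_(i))%MM = 0%MM :> 'X_{1..n}.
    by apply/mnmP=> k; rewrite mnmE subnn mnm0E.
  by rewrite mpolyX0 !alg_mpolyC -!mul_mpolyC -!mpolyCM ?mulr1 mulrC.
by rewrite mderivZ mderivX mnmE (negPf hj) !scale0r scaler0.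
Qed.

Lemma mpoly_alg_ind (P : {mpoly rat[n]} -> Prop) :
  (forall c, P c%:MP) -> (forall i, P 'X_i) ->
  (forall f g, P f -> P g -> P (f + g)) ->
  (forall f g, P f -> P g -> P (f * g)) -> forall f, P f.
Proof.
move=> hC hX hD hM; elim/mpolyind=> [|c m p _ _ hp]; first by rewrite -mpolyC0.
apply: hD => //; rewrite -mul_mpolyC; apply: (hM) => //.
rewrite mpolyXE_id; apply: (big_ind P) => [|f g|i _].
- by rewrite -mpolyC1.
- exact: hM.
- elim: (m i) => [|k ih]; rewrite ?expr0 -?mpolyC1 // exprS.
  by apply: (hM) => //; apply: hX.
Qed.

HB.instance Definition _ w :=
  GRing.LRMorphism.copy (@poly_act n w)
    (comp_mpoly [tuple \sum_(j < n) w i j *: 'X_j | i < n]).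

Lemma poly_actX w i : poly_act w 'X_i = lin (row i w).
Proof.
rewrite /poly_act comp_mpolyXU (nth_map i) ?size_enum_ord // nth_ord_enum.
by apply: eq_bigr => j _; rewrite mxE.
Qed.

Lemma poly_actC w c : poly_act w c%:MP = c%:MP.
Proof. exact: comp_mpolyC. Qed.

Lemma poly_act_lin w l : poly_act w (lin l) = lin (l *m w).
Proof.
rewrite [in LHS]/lin raddf_sum /= mulmx_sum_row raddf_sum /=.
apply: eq_bigr => i _.
by rewrite !linearZ /= poly_actX.
Qed.

Lemma poly_actM w1 w2 f : poly_act (w1 *m w2) f = poly_act w2 (poly_act w1 f).
Proof.
elim/mpoly_alg_ind: f => [c|i|f g hf hg|f g hf hg].
- by rewrite !poly_actC.
- by rewrite !poly_actX row_mul poly_act_lin.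
- by rewrite !raddfD /= hf hg.
- by rewrite !rmorphM /= hf hg.
Qed.

Lemma poly_act1 f : poly_act 1%:M f = f.
Proof.
elim/mpoly_alg_ind: f => [c|i|f g hf hg|f g hf hg].
- by rewrite !poly_actC.
- by rewrite poly_actX row1 lin_delta.
- by rewrite raddfD /= hf hg.
- by rewrite rmorphM /= hf hg.
Qed.

Lemma ev_poly_act w f x : ev (poly_act w f) x = ev f (w *m x).
Proof.
rewrite /ev; elim/mpoly_alg_ind: f => [c|i|f g hf hg|f g hf hg].
- by rewrite !poly_actC !mevalC.
- by rewrite poly_actX mevalXU [LHS]ev_lin /pairing -row_mul mxE.
- by rewrite (raddfD (poly_act w)) /= !mevalD hf hg.
- by rewrite rmorphM /= !mevalM hf hg.
Qed.

Lemma dirder_poly_act w x f :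
  dirder x (poly_act w f) = poly_act w (dirder (w *m x) f).
Proof.
elim/mpoly_alg_ind: f => [c|i|f g hf hg|f g hf hg].
- by rewrite !poly_actC !dirderC raddf0.
- rewrite poly_actX dirder_lin -lin_delta dirder_lin poly_actC -pairing_mulmx.
  by rewrite -rowE.
- by rewrite !raddfD /= hf hg.
- by rewrite rmorphM !dirderM hf hg /= raddfD /= !rmorphM.
Qed.

(** Write s for the substitution. Since fg - s(fg) = (f - sf) g + sf (g - sg), divisibility passes
    to products, and it is clear on variables. *)
Lemma srefl_dvd l b f : exists h, f - poly_act (srefl l b) f = lin l * h.
Proof.
elim/mpoly_alg_ind: f => [c|i|f g [u hu] [v hv]|f g [u hu] [v hv]].
- by exists 0; rewrite poly_actC subrr mulr0.
- exists (b i 0)%:MP; rewrite -(lin_delta i) poly_act_lin mul_rV_srefl.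
  rewrite -raddfB opprB addrC subrK /= linearZ /= mulrC mul_mpolyC pairingE.
  rewrite (bigD1 i) //= mxE !eqxx mul1r big1 ?addr0 // => j hj.
  by rewrite mxE (negPf hj) andbF mul0r.
- by exists (u + v); rewrite raddfD /= mulrDr -hu -hv; ring.
- exists (u * g + poly_act (srefl l b) f * v).
  rewrite rmorphM /= mulrDr mulrA -hu mulrCA -hv; ring.
Qed.

Lemma lin_dvd_anti l b f : poly_act (srefl l b) f = - f ->
  exists h, f = lin l * h.
Proof.
move=> hf; have [h] := srefl_dvd l b f; rewrite hf opprK => hh.
exists (2^-1 *: h); rewrite -scalerAr -hh -mulr2n -scaler_nat scalerA.
by rewrite mulVf ?scale1r.
Qed.

Lemma ev_anti l b f x : poly_act (srefl l b) f = - f ->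
  pairing l x = 0 -> ev f x = 0.
Proof.
move=> /lin_dvd_anti[h ->] hx; rewrite /ev mevalM.
by rewrite [_.@[_]](ev_lin l x) hx mul0r.
Qed.

Lemma mderiv_eq0_const f : (forall i, f^`M(i) = 0) -> f = (f@_0%MM)%:MP.
Proof.
move=> h; apply/mpolyP=> m; rewrite mcoeffC.
case: eqVneq => [->|hm]; first by rewrite mulr1.
rewrite mulr0; have [i hi] : exists i, m i != 0%N.
  apply/existsP; apply: contraR hm; rewrite negb_exists => /forallP hm.
  by apply/eqP/mnmP=> i; rewrite mnm0E; apply/eqP; have := hm i; rewrite negbK.
have := mcoeff_mderiv i f (m - U_(i))%MM; rewrite h mcoeff0 submK; last first.
  by apply/mnm_lepP=> j; rewrite mnmE; case: eqP => [<-|//]; rewrite lt0n.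
by move/esym/eqP; rewrite mulrn_eq0 /= => /eqP.
Qed.

Definition line_poly f (x y : 'cV[rat]_n) : {poly rat} :=
  mmap (@polyC rat) (fun i => (x i 0)%:P + (y i 0) *: 'X) f.

Lemma line_polyC (x y : 'cV[rat]_n) c :
  line_poly c%:MP x y = c%:P.
Proof. by rewrite /line_poly mmapC. Qed.

Lemma line_polyXU (x y : 'cV[rat]_n) i :
  line_poly 'X_i x y = (x i 0)%:P + (y i 0) *: 'X.
Proof. by rewrite /line_poly mmapX mmap1U. Qed.

Lemma line_polyD (x y : 'cV[rat]_n) f g :
  line_poly (f + g) x y = line_poly f x y + line_poly g x y.
Proof. exact: mmapD. Qed.

Lemma line_polyM (x y : 'cV[rat]_n) f g :
  line_poly (f * g) x y = line_poly f x y * line_poly g x y.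
Proof. exact: rmorphM. Qed.

Lemma horner_line_poly f x y t : (line_poly f x y).[t] = ev f (x + t *: y).
Proof.
rewrite /ev; elim/mpoly_alg_ind: f => [c|i|f g hf hg|f g hf hg].
- by rewrite line_polyC hornerC mevalC.
- by rewrite line_polyXU !hornerE mevalXU !mxE mulrC.
- by rewrite line_polyD hornerD hf hg mevalD.
- by rewrite line_polyM hornerM hf hg mevalM.
Qed.

Lemma deriv_line_poly f x y :
  (line_poly f x y)^`() = line_poly (dirder y f) x y.
Proof.
elim/mpoly_alg_ind: f => [c|i|f g hf hg|f g hf hg].
- by rewrite dirderC line_polyC derivC -mpolyC0 line_polyC.
- rewrite -(lin_delta i) dirder_lin line_polyC lin_delta line_polyXU.
  rewrite derivD derivC add0r derivZ derivX pairingE (bigD1 i) //= mxE !eqxx.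
  rewrite mul1r big1 ?addr0 => [|j hj].
    by rewrite alg_polyC.
  by rewrite mxE (negPf hj) andbF mul0r.
- by rewrite line_polyD derivD hf hg raddfD /= line_polyD.
- by rewrite line_polyM derivM hf hg dirderM line_polyD !line_polyM.
Qed.

Lemma poly_inj_roots_eq0 (p : {poly rat}) (t : nat -> rat) :
  injective t -> (forall k, p.[t k] = 0) -> p = 0.
Proof.
move=> ti h; apply/eqP/negPn/negP=> p0.
have := max_poly_roots p0 (rs := [seq t k | k <- iota 0 (size p)]).
rewrite map_inj_uniq // iota_uniq size_map size_iota ltnn => H.
by suff: false by []; apply: H => //; apply/allP=> u /mapP[k _ ->]; rewrite /root h.
Qed.

(** A function vanishing everywhere vanishes on each line, hence so do its partial derivatives; by
    induction on the degree these are 0 and [f] is constant. *)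
Lemma ev_eq0 f : (forall x, ev f x = 0) -> f = 0.
Proof.
move=> h; have: forall m, (msize f <= mdeg m)%N -> f@_m = 0.
  by move=> m /msize_mdeg_ge; apply: memN_msupp_eq0.
move: (msize f) => s; elim: s f h => [f _ hf|k ih f h hf].
  by apply/mpolyP=> m; rewrite hf ?mcoeff0.
have df i : f^`M(i) = 0.
  apply: ih => [x|m hm]; last first.
    by rewrite mcoeff_mderiv hf ?mul0rn // mdegD mdeg1 addn1.
  rewrite -dirder_delta -[x in LHS]addr0 -(scale0r (delta_mx i 0)).
  rewrite -horner_line_poly -deriv_line_poly.
  suff -> : line_poly f x (delta_mx i 0) = 0 by rewrite raddf0 horner0.
  apply: (@poly_inj_roots_eq0 _ (fun k => k%:R)) => [u v /eqP|u].
    by rewrite eqr_nat => /eqP.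
  by rewrite horner_line_poly.
by rewrite (mderiv_eq0_const df); move: (h 0);
rewrite {1}(mderiv_eq0_const df) /ev mevalC => ->.
Qed.

End PolyCalculus.

(** * Polynomials antisymmetric under an infinite dihedral group *)

Section Dihedral.
Variables (n : nat) (b c : 'rV[rat]_n) (x y : 'cV[rat]_n).

(* [cheb t k.+1] is the Chebyshev polynomial U_k evaluated at t / 2. *)
Fixpoint cheb (t : rat) (k : nat) : rat :=
  if k is k1.+1 then
    if k1 is k2.+1 then t * cheb t k1 - cheb t k2 else 1
  else 0.

Lemma chebSS t k : cheb t k.+2 = t * cheb t k.+1 - cheb t k.
Proof. by []. Qed.

Lemma cheb_lt t k : 2 <= `|t| -> `|cheb t k| < `|cheb t k.+1|.
Proof.
move=> ht; elim: k => [|k ih]; first by rewrite normr0 normr1.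
rewrite chebSS; have := lerB_dist (t * cheb t k.+1) (cheb t k).
rewrite normrM; have := normr_ge0 (cheb t k); nra.
Qed.

Lemma cheb_neq0 t k : 2 <= `|t| -> cheb t k.+1 != 0.
Proof. by move=> ht; rewrite -normr_gt0; apply: le_lt_trans (cheb_lt k ht). Qed.

Lemma cheb_add_neq0 t k : 2 <= `|t| -> cheb t k.+1 + cheb t k != 0.
Proof.
move=> ht; rewrite addr_eq0; apply/eqP=> h.
by have := cheb_lt k ht; rewrite h normrN ltxx.
Qed.

Lemma cheb_cassini t k : cheb t k.+1 ^+ 2 - cheb t k.+2 * cheb t k = 1.
Proof.
elim: k => [|k ih]; first by rewrite /= mulr0 subr0 expr1n.
by rewrite -[RHS]ih !chebSS; ring.
Qed.

(** By [cheb_cassini], consecutive ratios differ by the inverse of a product of consecutive values.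
    Multiplying by [t] makes the differences positive for either sign of [t]. *)
Lemma cheb_ratio_inj t : 2 <= `|t| ->
  injective (fun k => cheb t k / cheb t k.+1).
Proof.
move=> ht k m hkm.
have incr : {homo (fun k => t * (cheb t k / cheb t k.+1)) :
    i j / (i < j)%N >-> i < j}.
  apply: homo_ltn => [u v w|i]; first exact: lt_trans.
  have n0 := cheb_neq0 i ht; have n1 := cheb_neq0 i.+1 ht.
  have e : t * (cheb t i.+1 / cheb t i.+2) - t * (cheb t i / cheb t i.+1) =
      t * cheb t i.+1 * cheb t i.+2 / (cheb t i.+1 * cheb t i.+2) ^+ 2.
    rewrite -[t * cheb t i.+1 * _]mulr1 -(cheb_cassini t i); field.
    by rewrite n0 n1.
  rewrite -subr_gt0 e divr_gt0 //; last by rewrite exprn_even_gt0 //= mulf_neq0.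
  rewrite chebSS; have l := cheb_lt i ht.
  have : `|t * cheb t i.+1 * cheb t i| < (t * cheb t i.+1) ^+ 2.
    rewrite -(ger0_norm (sqr_ge0 _)) normrX !normrM expr2.
    have lc : `|cheb t i| < `|t| * `|cheb t i.+1|.
      by have := normr_ge0 (cheb t i); nra.
    by rewrite ltr_pM2l //; apply: le_lt_trans lc.
  move=> /(le_lt_trans (ler_norm _)); nra.
apply/eqP; move: hkm; case: (ltngtP k m) => // /incr /lt_eqF /eqP h1 h2.
  by case: h1; rewrite h2.
by case: h1; rewrite h2.
Qed.

Hypotheses (bx : pairing b x = 2) (cy : pairing c y = 2).
Let p := pairing b y.
Let q := pairing c x.

(* The lines on which a combination of b and c vanishes are permuted by the two
   reflections; starting from b = 0, the k-th image under their product is the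
   line in the hypothesis. *)
Lemma anti_vanish (g : {mpoly rat[n]}) :
  poly_act (srefl b x) g = - g -> poly_act (srefl c y) g = - g ->
  forall k z, (cheb (p * q - 2) k.+1 + cheb (p * q - 2) k) * pairing b z =
     p * cheb (p * q - 2) k * pairing c z -> ev g z = 0.
Proof.
move=> hb hc.
have evN s z : poly_act s g = - g -> ev g (s *m z) = 0 -> ev g z = 0.
  move=> hs; rewrite -ev_poly_act hs /ev mevalN => /eqP.
  by rewrite oppr_eq0 => /eqP.
elim=> [|k ih] z hz.
  by apply: ev_anti hb _; move: hz; rewrite /= addr0 mul1r mulr0 mul0r.
apply: (evN _ _ hb); apply: (evN _ _ hc); apply: ih; move: hz.
rewrite chebSS !mul_srefl_cV !(pairingBr, pairingZr) bx cy -/p -/q.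
move: (pairing b z) (pairing c z) (cheb _ _) (cheb _ _) => u v w1 w2 h.
by nra.
Qed.

(** A line along which c is a non-zero constant crosses the hyperplanes of [anti_vanish] at
    infinitely many points, so [g] vanishes on it. *)
Lemma anti_eq0 (g : {mpoly rat[n]}) :
  p != 0 -> p * q != 4 -> 2 <= `|p * q - 2| ->
  poly_act (srefl b x) g = - g -> poly_act (srefl c y) g = - g -> g = 0.
Proof.
move=> p0 pq4 ht hb hc.
have cn0 : lin c != 0.
  by rewrite lin_eq0; apply/eqP=> c0; move: cy; rewrite c0 /pairing mul0mx mxE.
(* The factor [lin c] disposes of the points with c(z) = 0, where the crossing points below would
   all coincide. *)
suff /eqP : lin c * g = 0 by rewrite mulf_eq0 (negPf cn0) => /eqP.
apply: ev_eq0 => z; rewrite /ev mevalM [X in X * _]ev_lin.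
have [->|cz] := eqVneq (pairing c z) 0; first by rewrite mul0r.
rewrite [X in _ * X](_ : _ = 0) ?mulr0 //.
set t := p * q - 2 in ht.
(* A direction killed by c and, since b(d) = 4 - pq is non-zero, not by b. *)
pose d := 2 *: x - q *: y.
have bd : pairing b d = 4 - p * q.
  by rewrite pairingBr !pairingZr bx -/p; ring.
have bd0 : 4 - p * q != 0 by rewrite subr_eq0 eq_sym.
have cd : pairing c d = 0 by rewrite pairingBr !pairingZr cy -/q; ring.
clearbody d.
(* The parameter at which the line z + s d meets the k-th hyperplane. *)
pose s k :=
  (p * cheb t k * pairing c z / (cheb t k.+1 + cheb t k) - pairing b z) / (4 - p * q).
suff l0 : line_poly g z d = 0.
  by rewrite -[z]addr0 -(scale0r d) -[LHS]/(ev _ _) -horner_line_poly l0 horner0.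
apply: (@poly_inj_roots_eq0 _ s) => [k m|k].
  move/(divIf bd0)/addIr => h; apply: (cheb_ratio_inj ht).
  have n0 := cheb_neq0 k ht; have n1 := cheb_neq0 m ht.
  have m0 := cheb_add_neq0 k ht; have m1 := cheb_add_neq0 m ht.
  apply/eqP; rewrite eqr_div //.
  move/eqP: h; rewrite eqr_div // => /eqP h; apply/eqP.
  have pc0 : p * pairing c z != 0 by rewrite mulf_neq0.
  apply: (mulfI pc0); lra.
rewrite horner_line_poly; apply: (anti_vanish hb hc (k := k)).
rewrite -/t !(pairingDr, pairingZr) bd cd /s.
have m0 := cheb_add_neq0 k ht; field; by rewrite bd0 m0.
Qed.
End Dihedral.

Lemma poly_act_dirder n (w : 'M[rat]_n) x f :
  w *m w = 1%:M -> poly_act w f = f ->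
  poly_act w (dirder x f) = dirder (w *m x) f.
Proof. by move=> ww hf; rewrite -{2}hf dirder_poly_act mulmxA ww mul1mx. Qed.

Definition mixed n (b c : 'rV[rat]_n) (x y : 'cV[rat]_n) (f : {mpoly rat[n]}) :=
  pairing b y *: (lin c * dirder x f) - pairing c x *: (lin b * dirder y f).

(** The reflection turns c into c - c(x) b and D_y into D_y - b(y) D_x; with the chosen weights the
    two extra terms in b D_x cancel. *)
Lemma mixed_anti n (b c : 'rV[rat]_n) (x y : 'cV[rat]_n) f :
  pairing b x = 2 -> poly_act (srefl b x) f = f ->
  poly_act (srefl b x) (mixed b c x y f) = - mixed b c x y f.
Proof.
move=> bx hf; have ss := sreflK bx.
rewrite /mixed [LHS]raddfB /= !linearZ /= !rmorphM /=.
rewrite !poly_act_lin !(poly_act_dirder _ ss) //.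
rewrite !mul_rV_srefl !mul_srefl_cV bx !linB !linZ.
rewrite subr_scaler2 dirderDl !dirderNl dirderZl -!mul_mpolyC mpolyCD; ring.
Qed.

Lemma mixed_eq0 n (b c : 'rV[rat]_n) (x y : 'cV[rat]_n) f :
  pairing b x = 2 -> pairing c y = 2 ->
  poly_act (srefl b x) f = f -> poly_act (srefl c y) f = f ->
  pairing b y != 0 -> pairing b y * pairing c x != 4 ->
  2 <= `|pairing b y * pairing c x - 2| -> mixed b c x y f = 0.
Proof.
move=> bx cy fb fc h1 h2 h3; apply: (anti_eq0 bx cy h1 h2 h3).
  exact: mixed_anti.
have -> : mixed b c x y f = - mixed c b y x f by rewrite /mixed opprB.
by rewrite raddfN /= mixed_anti.
Qed.

(** * Real roots *)

Notation toQ := (map_mx (intr : int -> rat)).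

Section Roots.
Variables (n : nat) (A : 'M[int]_n).
Implicit Types (b c d : 'rV[int]_n) (x y z : 'cV[int]_n).
Hypothesis cA : cartan_matrix A.

Definition sroot i : 'rV[int]_n := \row_j A j i.
Definition scoroot i : 'cV[int]_n := delta_mx i 0.
Definition srefl_simple i := srefl (sroot i) (scoroot i).

(* x is the coroot of the real root b. *)
Inductive is_root : 'rV[int]_n -> 'cV[int]_n -> Prop :=
| is_root_simple i : is_root (sroot i) (scoroot i)
| is_root_srefl i b x : is_root b x ->
    is_root (b *m srefl_simple i) (srefl_simple i *m x).

Lemma pairing_simple i j : pairing (sroot i) (scoroot j) = A j i.
Proof. by rewrite /scoroot pairing_delta mxE. Qed.

Lemma srefl_simpleK i : srefl_simple i *m srefl_simple i = 1%:M.
Proof. by apply: sreflK; rewrite pairing_simple; case: cA. Qed.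

Lemma pairing_root b x : is_root b x -> pairing b x = 2.
Proof.
elim=> [i|i b' x' _ ih]; first by rewrite pairing_simple; case: cA.
by rewrite pairing_mulmx mulmxA srefl_simpleK mul1mx.
Qed.

Lemma srefl_conj (S : 'M[int]_n) b x :
  S *m S = 1%:M -> srefl (b *m S) (S *m x) = S *m srefl b x *m S.
Proof.
move=> h; rewrite /srefl mulmxBr mulmxBl mulmx1 h; congr (_ - _).
by rewrite !mulmxA.
Qed.

Lemma is_root_act c y b x : is_root c y -> is_root b x ->
  is_root (b *m srefl c y) (srefl c y *m x).
Proof.
move=> hc; elim: hc b x => [i|i c' y' _ ih] b x hb; first exact: (is_root_srefl i hb).
rewrite srefl_conj ?srefl_simpleK //.
have := is_root_srefl i (ih _ _ (is_root_srefl i hb)).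
by rewrite !mulmxA.
Qed.

Lemma reflection_srefl i : lin1_mx (reflection A i) = toQ (srefl_simple i).
Proof.
apply/row_matrixP=> j; rewrite [LHS]rowE mul_reflection_mx map_srefl rowE.
rewrite mul_rV_srefl.
rewrite /scoroot map_delta_mx pairing_delta /reflection; congr (_ - _ *: _).
by apply/rowP=> k; rewrite !mxE.
Qed.

Lemma inv_ringP f :
  inv_ring A f <-> forall i, poly_act (toQ (srefl_simple i)) f = f.
Proof.
split=> [h i|h w]; first by rewrite -reflection_srefl; apply/h/weyl_reflection.
elim=> [|i|w1 w2 _ h1 _ h2|u _ hu].
- exact: poly_act1.
- by rewrite reflection_srefl.
- by rewrite poly_actM h1 h2.
(* [invmx] returns a singular matrix unchanged, so that case needs only the induction hypothesis. *)
- rewrite -{1}hu /invmx; case: ifP => hw; last by rewrite !hu.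
  have hw' : u \in unitmx by [].
  have := mulmxV hw'; rewrite /invmx hw => e.
  by rewrite -poly_actM e poly_act1.
Qed.

(** * Roots with proportional derivatives *)

Section Rel.
Variable f : {mpoly rat[n]}.
Hypothesis finv : inv_ring A f.

Lemma poly_act_root b x : is_root b x -> poly_act (srefl (toQ b) (toQ x)) f = f.
Proof.
rewrite -map_srefl; elim=> [i|i b' x' _ ih]; first by move/inv_ringP: finv; apply.
rewrite srefl_conj ?srefl_simpleK // !map_mxM !poly_actM.
by rewrite !(inv_ringP f).1 // ih (inv_ringP f).1.
Qed.

Lemma toQ_pairing b x : pairing (toQ b) (toQ x) = (pairing b x)%:~R.
Proof. exact: map_pairing. Qed.

Lemma toQ_root b x : is_root b x -> pairing (toQ b) (toQ x) = 2.
Proof. by move=> h; rewrite toQ_pairing pairing_root. Qed.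

Lemma lin_root_neq0 b x : is_root b x -> lin (toQ b) != 0.
Proof.
move=> h; rewrite lin_eq0; apply/eqP=> b0; have := toQ_root h.
by rewrite b0 /pairing mul0mx mxE.
Qed.

(** D_x f / b is a non-zero multiple of D_y f / c, with the denominators cleared to stay among
    polynomials. *)
Definition rel b x c y : Prop := exists2 k : rat, k != 0 &
  lin (toQ c) * dirder (toQ x) f = k *: (lin (toQ b) * dirder (toQ y) f).

Lemma rel_refl b x : rel b x b x.
Proof. by exists 1; rewrite ?scale1r. Qed.

Lemma rel_sym b x c y : rel b x c y -> rel c y b x.
Proof.
move=> [k k0 e]; exists k^-1; first by rewrite invr_eq0.
by rewrite e scalerA mulVf // scale1r.
Qed.

Lemma rel_trans b x c y d z : is_root c y ->
  rel b x c y -> rel c y d z -> rel b x d z.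
Proof.
move=> hc [k k0 e1] [m m0 e2]; exists (k * m); first by rewrite mulf_neq0.
apply: (mulfI (lin_root_neq0 hc)).
rewrite mulrCA e1 -scalerAr mulrCA e2 -!scalerAr scalerA; congr (_ *: _).
by rewrite mulrCA.
Qed.

Lemma rel_act d z b x c y : is_root d z -> rel b x c y ->
  rel (b *m srefl d z) (srefl d z *m x) (c *m srefl d z) (srefl d z *m y).
Proof.
move=> hd [k k0 e]; exists k => //.
have := congr1 (poly_act (srefl (toQ d) (toQ z))) e.
rewrite linearZ /= !rmorphM /= !poly_act_lin.
rewrite !poly_act_dirder ?sreflK ?toQ_root ?poly_act_root //.
by rewrite -!map_srefl -!map_mxM.
Qed.

Lemma rel_negl b x c y : rel (- b) (- x) c y -> rel b x c y.
Proof.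
move=> [k k0 e]; exists k => //; apply: oppr_inj.
by move: e; rewrite !map_mxN linN dirderNl mulrN mulNr scalerN.
Qed.

(** The reflection negates both b and x, and the two signs cancel in D_x f / b. *)
Lemma rel_srefl b x c y : is_root b x -> rel b x c y ->
  rel b x (c *m srefl b x) (srefl b x *m y).
Proof.
move=> hb h; apply: rel_negl; have := rel_act hb h.
rewrite mul_rV_srefl mul_srefl_cV pairing_root //.
by rewrite !scaler_nat !mulr2n !opprD !addrA !subrr !sub0r.
Qed.

Hypothesis df_neq0 : forall b x, is_root b x -> dirder (toQ x) f != 0.

(** A non-zero integer factor [q] cannot decrease the absolute value. The products 1 to 4 are those
    that [nonfinite_pair_rel] has to avoid. *)
Lemma mul_le0_or_gt4 (p q : int) : 4 < `|p| -> p * q <= 0 \/ 4 < p * q.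
Proof.
move=> hp; have [h|h] := leP (p * q) 0; [by left|right].
have q0 : q != 0 by apply: contraTneq h => ->; rewrite mulr0.
rewrite -(ger0_norm (ltW h)) normrM; move: q0; rewrite -normr_gt0; nia.
Qed.

Lemma nonfinite_pair_rel b x c y : is_root b x -> is_root c y ->
  pairing b y != 0 ->
  pairing b y * pairing c x <= 0 \/ 4 < pairing b y * pairing c x ->
  pairing c x != 0 /\ rel b x c y.
Proof.
move=> hb hc h0 h1.
have := mixed_eq0 (toQ_root hb) (toQ_root hc)
  (poly_act_root hb) (poly_act_root hc).
rewrite /mixed !toQ_pairing -!rmorphM /= intr_eq0 h0 => /(_ isT).
set p := pairing b y in h0 h1 *; set q := pairing c x in h1 *.
have -> : ((p * q)%:~R != 4 :> rat) by rewrite (eqr_int _ _ 4); lia.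
have -> : 2 <= `|(p * q)%:~R - 2 : rat|.
  have -> : 2 = (2 : int)%:~R :> rat by [].
  by rewrite -intrB -intr_norm ler_int; lia.
move=> /(_ isT isT) /eqP; rewrite subr_eq0 => /eqP e.
have p0 : (p%:~R : rat) != 0 by rewrite intr_eq0.
(* If c(x) were 0, the identity [e] would say that b(y) c D_x f = 0, a product of three non-zero
   factors. *)
have q0 : (q%:~R : rat) != 0.
  apply/eqP=> q0; move/eqP: e; rewrite q0 scale0r -mul_mpolyC mulf_eq0.
  rewrite mpolyC_eq0 (negPf p0) /= mulf_eq0 (negPf (lin_root_neq0 hc)) /=.
  by rewrite (negPf (df_neq0 hb)).
split; first by rewrite intr_eq0 in q0.
exists (p%:~R^-1 * q%:~R); first by rewrite mulf_neq0 ?invr_eq0.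
by rewrite -scalerA -e scalerA mulVf // scale1r.
Qed.

(** The traces are integers, so the bound 3 expresses that the product of the two reflections has
    trace beyond 2 in absolute value. *)
Definition hyperbolic b x := is_root b x /\ exists c y,
  [/\ is_root c y, rel b x c y & 3 <= `|pairing b y * pairing c x - 2|].

(* A root d unrelated to b satisfies |b(z)| <= 4 by [nonfinite_pair_rel], and so
   do its images under the reflections in b and c.  The product of these
   reflections has trace [pairing b y * pairing c x - 2] on the plane of b and
   c, which is at least 3 in absolute value, so the bound improves from 4 to 2,
   then 1, then 0. *)
Lemma hyperbolic_rel b x d z : hyperbolic b x -> is_root d z ->
  pairing b z != 0 -> rel b x d z.
Proof.
move=> [hb [c [y [hc bc ht]]]].
pose P m := forall d z, is_root d z -> (m < `|pairing b z|) -> rel b x d z.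
have step m m' : P m -> 2 * m < 3 * m' + 3 -> P m'.
  move=> hm hmm' e u he hu.
  pose e1 := e *m srefl c y; pose u1 := srefl c y *m u.
  pose e2 := e *m srefl b x *m srefl c y.
  pose u2 := srefl c y *m (srefl b x *m u).
  have he1 : is_root e1 u1 by exact: is_root_act.
  have he2 : is_root e2 u2 by do 2!apply: is_root_act => //.
  (* If [u1] and [u2] both pair with b to at most m in absolute value, this gives 3 |b(u)| <= 2m,
     which excludes |b(u)| >= m' + 1. *)
  have dE : pairing b u2 - pairing b u1 =
      (pairing b y * pairing c x - 2) * pairing b u.
    rewrite /u2 /u1 !mul_srefl_cV !(pairingBr, pairingZr) (pairing_root hb).
    by ring.
  (* To relate b to a root it suffices to relate b to its image under reflection in some root
     already related to b. *)
  have back c' y' e' u' : is_root c' y' -> rel b x c' y' ->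
      rel b x (e' *m srefl c' y') (srefl c' y' *m u') -> rel b x e' u'.
    move=> hc' bc' h.
    have := rel_srefl hc' (rel_trans hb (rel_sym bc') h).
    rewrite -mulmxA [srefl c' y' *m (_ *m u')]mulmxA sreflK ?pairing_root //.
    by rewrite mulmx1 mul1mx; apply: rel_trans.
  have [h|h] := ltP m `|pairing b u1|.
    by apply: (back c y) => //; apply: hm.
  have [h'|h'] := ltP m `|pairing b u2|.
    apply: (back b x) => //; first exact: rel_refl.
    by apply: (back c y) => //; apply: hm.
  move: dE ht hu.
  move: (pairing b u) (_ - 2) (pairing b u1) (pairing b u2) h h' => v t v1 v2.
  by move=> h h' dE ht hu; have := normrM t v; rewrite -dE; nia.
have P4 : P 4.
  move=> e u he hu; have [e0|e0] := eqVneq (pairing b u) 0.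
    by move: hu; rewrite e0 normr0.
  by have [] := nonfinite_pair_rel hb he e0 (mul_le0_or_gt4 _ hu).
have P0 : P 0 by apply: (step 1) => //; apply: (step 2) => //; apply: (step 4).
by move=> hd h0; apply: P0; rewrite ?normr_gt0.
Qed.

Lemma hyperbolic_act b x d z : hyperbolic b x -> is_root d z ->
  hyperbolic (b *m srefl d z) (srefl d z *m x).
Proof.
move=> [hb [c [y [hc bc ht]]]] hd; split; first exact: is_root_act.
exists (c *m srefl d z), (srefl d z *m y); split; first exact: is_root_act.
  exact: rel_act.
have e b' x' : pairing (b' *m srefl d z) (srefl d z *m x') = pairing b' x'.
  by rewrite pairing_mulmx mulmxA sreflK ?mul1mx ?(pairing_root hd).
by rewrite !e.
Qed.

Hypothesis connA : forall S : {set 'I_n}, S != set0 -> S != setT ->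
  exists i j, [/\ i \in S, j \notin S & A i j != 0].

(** [U] collects the k whose coroot pairs non-trivially with some hyperbolic root related to the
    simple root i0; [hyperbolic_rel] then relates the simple root k. [U] is closed under neighbours:
    if b pairs with j but not with its neighbour k, the reflection of b in the simple root j pairs
    with k. *)
Lemma simple_roots_rel i0 : hyperbolic (sroot i0) (scoroot i0) ->
  forall k, rel (sroot i0) (scoroot i0) (sroot k) (scoroot k).
Proof.
move=> h0.
pose good b x := hyperbolic b x /\ rel (sroot i0) (scoroot i0) b x.
pose U := [set k | `[< exists b x, good b x /\ pairing b (scoroot k) != 0 >]].
have gU k : k \in U -> rel (sroot i0) (scoroot i0) (sroot k) (scoroot k).
  rewrite inE => /asboolP[b [x [[hb rb] hk]]].
  apply: rel_trans (hb.1) rb _; apply: hyperbolic_rel => //.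
  exact: is_root_simple.
suff UT : U = setT by move=> k; apply: gU; rewrite UT inE.
apply/eqP/negPn/negP=> UT.
have U0 : U != set0.
  apply/set0Pn; exists i0; rewrite inE; apply/asboolP.
  exists (sroot i0), (scoroot i0); split; first by split=> //; exact: rel_refl.
  by rewrite pairing_simple; case: cA => ->.
have [j [k [jU kU jk]]] := connA U0 UT; case/negP: kU.
have rj := gU _ jU; move: jU; rewrite !inE => /asboolP[b [x [[hb rb] hj]]].
apply/asboolP; have [bk|bk] := eqVneq (pairing b (scoroot k)) 0; last first.
  by exists b, x.
exists (b *m srefl (sroot j) (scoroot j)), (srefl (sroot j) (scoroot j) *m x).
split; first split.
- by apply: hyperbolic_act => //; exact: is_root_simple.
- apply: (rel_trans (is_root_simple j) rj).
  apply: rel_srefl (is_root_simple j) _.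
  exact: rel_trans (is_root_simple i0) (rel_sym rj) rb.
- rewrite mul_rV_srefl pairingBl pairingZl bk sub0r oppr_eq0 mulf_neq0 //.
  rewrite pairing_simple; case: cA => _ _ h; apply: contra jk => /eqP /h ->.
  by [].
Qed.

End Rel.

Lemma root_unbounded_hyperbolic (f : {mpoly rat[n]}) c y i :
  inv_ring A f -> (forall b x, is_root b x -> dirder (toQ x) f != 0) ->
  is_root c y -> 4 < `|pairing c (scoroot i)| ->
  hyperbolic f (sroot i) (scoroot i).
Proof.
move=> finv df hc hp; split; first exact: is_root_simple.
have hi := is_root_simple i.
have c0 : pairing c (scoroot i) != 0 by rewrite -normr_gt0; apply: lt_trans hp.
have [a0 r] := nonfinite_pair_rel finv df hc hi c0 (mul_le0_or_gt4 _ hp).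
exists c, y; split=> //; first exact: rel_sym.
rewrite mulrC; set p := pairing c _ in hp *; set q := pairing _ y in a0 *.
(* As |pq| is at least 5, the trace pq - 2 is at least 3 in absolute value. *)
have : `|p * q| >= 5 by rewrite normrM; move: a0; rewrite -normr_gt0; nia.
lia.
Qed.
End Roots.

(** * Bounded root systems *)

Lemma cartan_mxsub m n (g : 'I_m -> 'I_n) (A : 'M[int]_n) :
  injective g -> cartan_matrix A -> cartan_matrix (mxsub g g A).
Proof.
move=> gi [A2 A0 Az]; split=> [i|i j ij|i j].
- by rewrite mxE.
- by rewrite mxE A0 // inj_eq.
- by rewrite !mxE; apply: Az.
Qed.

(** If no entry leads out of S, listing S before its complement makes [A] block diagonal; the second
    off-diagonal block vanishes by the symmetry of the zero pattern. *)
Lemma indecomposable_connected n (A : 'M[int]_n) :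
  cartan_matrix A -> indecomposable A ->
  forall S : {set 'I_n}, S != set0 -> S != setT ->
  exists i j, [/\ i \in S, j \notin S & A i j != 0].
Proof.
move=> cA iA S S0 ST; apply: contrapT => hS; apply: iA.
have AS i j : i \in S -> j \in ~: S -> A i j = 0.
  rewrite inE => iS jS; apply/eqP/negPn/negP => h; apply: hS.
  by exists i, j.
have e : (#|S| + #|~: S| = n)%N by rewrite cardsC card_ord.
pose g (i : 'I_(#|S| + #|~: S|)) : 'I_n :=
  match split i with inl k => enum_val k | inr k => enum_val k end.
have gi : injective g.
  move=> i j; rewrite /g; case: (splitP i) (splitP j) => k ki [] l lj h.
  - by apply: val_inj; rewrite /= ki lj (enum_val_inj h).
  - by have := enum_valP l; rewrite -h inE enum_valP.
  - by have := enum_valP k; rewrite h inE enum_valP.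
  - by apply: val_inj; rewrite /= ki lj (enum_val_inj h).
have si : injective (fun i => g (cast_ord (esym e) i)).
  by move=> i j /gi /cast_ord_inj.
exists #|S|, #|~: S|, e, (perm si).
exists (mxsub enum_val enum_val A), (mxsub enum_val enum_val A); split.
- rewrite -[X in (_ < X)%N]e -[X in (X < _)%N]addn0 ltn_add2l card_gt0.
  apply: contra ST => /eqP h; by rewrite -[S]setCK h setC0.
- by rewrite -[X in (_ < X)%N]e -[X in (X < _)%N]add0n ltn_add2r card_gt0.
- exact: cartan_mxsub (@enum_val_inj _ _) cA.
- exact: cartan_mxsub (@enum_val_inj _ _) cA.
apply/matrixP=> i j; rewrite castmxE !mxE !permE /g.
case: (splitP (cast_ord _ i)) => k _; rewrite !mxE;
  case: (splitP (cast_ord _ j)) => l _; rewrite ?mxE //.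
- by rewrite AS ?enum_valP.
- by case: cA => _ _; apply; rewrite AS ?enum_valP.
Qed.

(** * Gram matrices *)

Section Gram.
Variable R : realFieldType.

Lemma gram_sq m (u : 'cV[R]_m) : (u^T *m u) 0 0 = \sum_i u i 0 ^+ 2.
Proof. by rewrite mxE; apply: eq_bigr => i _; rewrite mxE. Qed.

Lemma gram_eq0 m (u : 'cV[R]_m) : (u^T *m u) 0 0 <= 0 -> u = 0.
Proof.
rewrite gram_sq => h; apply/colP=> i; rewrite mxE.
have s0 : \sum_i u i 0 ^+ 2 == 0.
  by rewrite eq_le h sumr_ge0 // => j _; apply: sqr_ge0.
move: s0; rewrite psumr_eq0 => [|j _]; last exact: sqr_ge0.
by move=> /allP /(_ i (mem_index_enum _)) /=; rewrite sqrf_eq0 => /eqP.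
Qed.

Lemma gram_mul_eq0 m n (V : 'M[R]_(m, n)) (x : 'cV[R]_n) :
  V^T *m V *m x = 0 -> V *m x = 0.
Proof.
move=> h; apply: gram_eq0.
by rewrite trmx_mul -mulmxA (mulmxA V^T) h mulmx0 mxE.
Qed.

(** One Gram-Schmidt step: subtracting from the other columns their projections on the first is a
    unitriangular change, after which the determinant is the squared norm of [u] times a smaller
    Gram determinant. *)
Lemma gram_det_ge0 m n (V : 'M[R]_(m, n)) : 0 <= \det (V^T *m V).
Proof.
elim: n V => [|n ih] V; first by rewrite det_mx00.
pose u : 'cV_m := lsubmx (V : 'M_(m, 1 + n)).
pose W := rsubmx (V : 'M_(m, 1 + n)).
have VE : V = row_mx u W :> 'M_(m, 1 + n) by rewrite hsubmxK.
(* If u = 0 the inverse below is 0, which is what is needed. *)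
pose c : 'rV[R]_n := ((u^T *m u) 0 0)^-1 *: (u^T *m W); pose X := W - u *m c.
have uX : u^T *m X = 0.
  rewrite mulmxBr mulmxA [u^T *m u]mx11_scalar mul_scalar_mx scalerA.
  have [->|u0] := eqVneq u 0; first by rewrite trmx0 !mul0mx scaler0 subrr.
  rewrite divff ?scale1r ?subrr //; apply: contra_neq u0 => h.
  by apply: gram_eq0; rewrite h.
pose T : 'M[R]_(1 + n) := block_mx 1%:M c 0 1%:M.
have VT : V = row_mx u X *m T :> 'M_(m, 1 + n).
  by rewrite mul_row_block !mulmx1 mulmx0 addr0 [X in row_mx _ X]addrC subrK.
have -> : V^T *m V = T^T *m (row_mx u X : 'M_(m, 1 + n))^T *m (row_mx u X *m T).
  by rewrite -trmx_mul -VT.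
rewrite -mulmxA (mulmxA _ (row_mx u X)) !det_mulmx det_tr.
have -> : \det T = 1 by rewrite det_ublock !det1 mulr1.
rewrite mul1r mulr1 tr_row_mx mul_col_row uX.
rewrite -[X^T *m u]trmxK trmx_mul trmxK uX trmx0 (@det_ublock _ 1 n).
rewrite mulr_ge0 //.
by rewrite det_mx11 gram_sq sumr_ge0 // => i _; apply: sqr_ge0.
Qed.

Lemma gram_det_gt0 m n (V : 'M[R]_(m, n)) :
  (forall x : 'cV_n, V *m x = 0 -> x = 0) -> 0 < \det (V^T *m V).
Proof.
move=> h; rewrite lt_def gram_det_ge0 andbT -unitfE -unitmxE.
rewrite -row_free_unit -kermx_eq0; apply/eqP/row_matrixP=> i; rewrite row0.
apply: trmx_inj; rewrite trmx0; apply/h/gram_mul_eq0.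
apply: trmx_inj; rewrite trmx0 !trmx_mul !trmxK.
by apply: sub_kermxP; apply: row_sub.
Qed.
End Gram.

(** * The invariant form of a finite set of roots *)

Section FiniteRoots.
Variables (n : nat) (A : 'M[int]_n).
Hypothesis cA : cartan_matrix A.
Hypothesis bounded : forall c y i, is_root A c y ->
  `|pairing c (scoroot i)| <= 4.

Lemma roots_enum : exists s : seq 'rV[int]_n,
  uniq s /\ forall c, c \in s <-> exists y, is_root A c y.
Proof.
(* The coordinates of a root are its pairings with the simple coroots, integers from -4 to 4;
   shifted by 4 they fit in ['I_9]. *)
pose dec (v : 'rV['I_9]_n) : 'rV[int]_n := \row_j ((v 0 j : nat)%:Z - 4).
exists (undup [seq c <- [seq dec v | v <- enum {: 'rV['I_9]_n}] |
  `[< exists y, is_root A c y >]]).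
split=> [|c]; first exact: undup_uniq.
rewrite mem_undup mem_filter; split=> [/andP[/asboolP]|[y hy]] //.
apply/andP; split; first by apply/asboolP; exists y.
apply/mapP; exists (\row_j inord (absz (c 0 j + 4))); first by rewrite mem_enum.
apply/rowP=> j; rewrite !mxE.
have := bounded j hy; rewrite /scoroot pairing_delta => hj.
by move: (c 0 j) hj => v hj; rewrite inordK; lia.
Qed.

(** The rows of [V] are all the roots, so B is the sum of c(x) c(y) over the roots c. Each simple
    reflection permutes the roots, and the equation expresses the resulting invariance. *)
Lemma finite_roots_gram : exists m (V : 'M[rat]_(m, n)), let B := V^T *m V in
  forall i j, 0 < B i i /\ 2 * B i j = (A j i)%:~R * B i i.
Proof.
have [s [us hs]] := roots_enum.
exists (size s), (\matrix_(k, j) (s`_k 0 j)%:~R) => B.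
have BE i j : B i j = \sum_(c <- s) ((c 0 i)%:~R * (c 0 j)%:~R).
  rewrite mxE (big_nth 0) big_mkord; apply: eq_bigr => k _; by rewrite !mxE.
move=> i j; split.
  have rs : sroot A i \in s.
    by apply/hs; exists (scoroot i); exact: is_root_simple.
  rewrite BE (perm_big _ (perm_to_rem rs)) big_cons /= ltr_wpDr //.
    by apply: sumr_ge0 => c _; rewrite -expr2 sqr_ge0.
  by rewrite mxE; case: cA => -> _ _.
have pe : perm_eq s [seq c *m srefl_simple A i | c <- s].
  have inj : injective (fun c : 'rV[int]_n => c *m srefl_simple A i).
    apply: (can_inj (g := fun c => c *m srefl_simple A i)) => c.
    by rewrite -mulmxA srefl_simpleK ?mulmx1.
  have sub : {subset [seq c *m srefl_simple A i | c <- s] <= s}.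
    move=> _ /mapP[c /hs[y hy] ->]; apply/hs.
    by exists (srefl_simple A i *m y); exact: is_root_srefl.
  have [] := uniq_min_size (s1 := [seq c *m srefl_simple A i | c <- s]) _ sub _.
  - by rewrite map_inj_uniq.
  - by rewrite size_map.
  - by move=> _ h; apply: uniq_perm; rewrite ?map_inj_uniq // => c; rewrite h.
have := BE i j; rewrite (perm_big _ pe) big_map /= => e.
(* Reindexing by the reflection in i replaces c(i) by -c(i) and c(j) by c(j) - c(i) [A j i]. *)
suff : B i j = - B i j + (A j i)%:~R * B i i.
  by move=> h; rewrite mulr_natl mulr2n {1}h; ring.
rewrite {1}e !BE mulr_sumr -sumrN -big_split /=; apply: eq_bigr => c _.
rewrite /srefl_simple mul_rV_srefl /scoroot pairing_delta !mxE.
case: cA => -> _ _; rewrite !rmorphB !rmorphM /=; ring.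
Qed.
End FiniteRoots.

(** * From a semidefinite form to finite or affine type *)

Section GramType.
Variables (n m : nat) (A : 'M[int]_n) (V : 'M[rat]_(m, n)).
Hypothesis cA : cartan_matrix A.
Hypothesis iA : indecomposable A.
Let B := V^T *m V.
Hypothesis hB : forall i j, 0 < B i i /\ 2 * B i j = (A j i)%:~R * B i i.

Let B_sym : B^T = B.
Proof. by rewrite /B trmx_mul trmxK. Qed.

(* As B is positive semidefinite with nonpositive off-diagonal entries, passing
   to absolute values does not increase the form: |x| is again in the kernel. *)
Lemma gram_kernel (x : 'cV[rat]_n) i : B *m x = 0 -> x i 0 = 0 -> x = 0.
Proof.
move=> Bx xi; pose y : 'cV[rat]_n := \col_j `|x j 0|.
have yE j : y j 0 = `|x j 0| by rewrite mxE.
have Boff j k : j != k -> B j k <= 0.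
  move=> jk; have [Bj e] := hB j k; case: cA => _ /(_ k j) A0 _.
  have : (A k j)%:~R <= 0 :> rat by rewrite lerz0 A0 // eq_sym.
  by move=> h; nra.
have quad (z : 'cV[rat]_n) : (z^T *m B *m z) 0 0 =
    \sum_j \sum_k z j 0 * B j k * z k 0.
  rewrite mxE exchange_big /=; apply: eq_bigr => k _; rewrite mxE mulr_suml.
  by apply: eq_bigr => j _; rewrite mxE.
have By : B *m y = 0.
  rewrite /B -mulmxA (_ : V *m y = 0) ?mulmx0 //; apply: gram_eq0.
  rewrite trmx_mul mulmxA -(mulmxA _ _ V) -/B quad.
  have : (x^T *m B *m x) 0 0 = 0 by rewrite -mulmxA Bx mulmx0 mxE.
  rewrite quad => qx; rewrite -[leRHS]qx; apply: ler_sum => j _.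
  apply: ler_sum => k _.
  rewrite !yE.
  have [<-|jk] := eqVneq j k.
    by rewrite -!mulrA !(mulrCA _ (B j j)) -normrM ger0_norm // -expr2 sqr_ge0.
  have := Boff _ _ jk; rewrite -!mulrA !(mulrCA _ (B j k)) -normrM.
  by have := ler_norm (x j 0 * x k 0); nra.
pose S := [set j | x j 0 == 0].
have [ST|ST] := eqVneq S setT.
  by apply/colP=> j; have := in_setT j; rewrite -ST inE mxE => /eqP.
have S0 : S != set0 by apply/set0Pn; exists i; rewrite inE xi.
have [j [k [jS kS]]] := indecomposable_connected cA iA S0 ST.
rewrite !inE in jS kS.
(* As [y] vanishes at j, every term of this sum is nonpositive, hence zero; the term at k
   contradicts the edge from j to k. *)
have : (B *m y) j 0 = 0 by rewrite By mxE.
rewrite mxE => /eqP.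
rewrite -oppr_eq0 -sumrN psumr_eq0 => [|l _]; last first.
  rewrite oppr_ge0 yE; have [<-|jl] := eqVneq j l.
    by rewrite (eqP jS) normr0 mulr0.
  by rewrite mulr_le0_ge0 ?Boff.
move=> /allP /(_ k (mem_index_enum _)) /=.
rewrite oppr_eq0 yE mulf_eq0 normr_eq0 (negPf kS) orbF => /eqP Bjk.
have [Bj] := hB j k; rewrite Bjk mulr0 => /esym/eqP.
rewrite mulf_eq0 intr_eq0 (gt_eqF Bj) orbF => /eqP h.
by case: cA => _ _ /(_ _ _ h) ->; rewrite eqxx.
Qed.

Let d : 'rV[rat]_n := \row_i (2 / B i i).

Let dE i : d 0 i = 2 / B i i.
Proof. by rewrite mxE. Qed.

Let d_gt0 i : 0 < d 0 i.
Proof. by rewrite dE divr_gt0 //; case: (hB i i). Qed.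

Lemma map_tr_gram : (map_mx intr A)^T = diag_mx d *m B.
Proof.
apply/matrixP=> i j; have [Bi e] := hB i j.
rewrite mul_diag_mx [RHS]mxE dE mulrAC e mulfK ?lt0r_neq0 //.
by rewrite !mxE.
Qed.

(** The transpose of [A] is [B] with rows scaled by the positive [d], so restricting to S leaves the
    Gram determinant of the columns of [V] in S, selected by [P]. *)
Lemma minor_gram (S : {set 'I_n}) : exists2 c : rat, 0 < c &
  let P := colsub (@enum_val _ (mem S)) 1%:M in
  (principal_minor A S)%:~R = c * \det ((V *m P)^T *m (V *m P)).
Proof.
exists (\prod_i d 0 (@enum_val _ (mem S) i)); first by apply: prodr_gt0.
move=> P.
have -> : (V *m P)^T *m (V *m P) = P^T *m B *m P.
  by rewrite trmx_mul /B !mulmxA.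
rewrite /principal_minor -det_map_mx -det_tr map_mxsub.
pose dS := colsub (@enum_val _ (mem S)) d.
have -> : \prod_i d 0 (@enum_val _ (mem S) i) = \det (diag_mx dS).
  by rewrite det_diag; apply: eq_bigr => i _; rewrite [RHS]mxE.
rewrite -det_mulmx; congr (\det _).
rewrite trmx_mxsub map_tr_gram; apply/matrixP=> i j.
have PE (M : 'M[rat]_n) : P^T *m M *m P =
    mxsub (@enum_val _ (mem S)) (@enum_val _ (mem S)) M.
  rewrite -mulmxA mulmx_colsub mulmx1 trmx_mxsub trmx1 mul_rowsub_mx mul1mx.
  by apply/matrixP=> k l; rewrite !mxE.
transitivity (d 0 (enum_val i) * B (enum_val i) (enum_val j)).
  by rewrite mxE mul_diag_mx mxE.
rewrite PE mul_diag_mx [RHS]mxE; congr (_ * _); by rewrite [RHS]mxE.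
Qed.

(** If [V] is injective, all Gram determinants are positive. Otherwise non-zero kernel vectors have
    no zero coordinate by [gram_kernel], so any two are proportional and the corank is 1. *)
Lemma gram_finite_or_affine : finite_type A \/ affine_type A.
Proof.
have [inj|ninj] := pselect (forall x : 'cV_n, V *m x = 0 -> x = 0).
  left=> S; have [c c0 /= e] := minor_gram S.
  rewrite -(ltr0z rat) e pmulr_rgt0 //; apply: gram_det_gt0 => x.
  rewrite -mulmxA => /inj h; set P := colsub _ _ in h.
  have PP : P^T *m P = 1%:M.
    apply/matrixP=> i j; rewrite !mxE (bigD1 (enum_val i)) //= !mxE eqxx mul1r.
    rewrite big1 ?addr0 => [|k ki]; first by rewrite (inj_eq enum_val_inj).
    by rewrite !mxE (negPf ki) mul0r.
  by rewrite -[x]mul1mx -PP -mulmxA h mulmx0.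
right; split=> [S|].
  have [c c0 /= e] := minor_gram S.
  by rewrite -(ler0z rat) e pmulr_rge0 // gram_det_ge0.
have [x [Vx x0]] : exists x : 'cV_n, V *m x = 0 /\ x <> 0.
  apply: contrapT => h; apply: ninj => x Vx; apply: contrapT => x0.
  by apply: h; exists x.
have Bx : B *m x = 0 by rewrite /B -mulmxA Vx mulmx0.
have xi i : x i 0 != 0 by apply/eqP=> h; apply: x0; apply: gram_kernel h.
have rA : \rank (map_mx intr A : 'M[rat]_n) = \rank B.
  rewrite -mxrank_tr map_tr_gram eqmxMfull // row_full_unit.
  rewrite unitmxE det_diag unitfE.
  by apply/prodf_neq0=> i _; rewrite lt0r_neq0.
rewrite rA; have rk := mxrank_ker B.
have k1 : (\rank (kermx B) <= 1)%N.
  apply: leq_trans (rank_leq_row x^T); apply: mxrankS; apply/row_subP=> i.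
  set y := row i _; have yB : y *m B = 0 by apply/sub_kermxP/row_sub.
  have : (y - (y 0 i / x i 0) *: x^T)^T = 0.
    apply: (@gram_kernel _ i); last by rewrite !mxE divfK ?xi // subrr.
    rewrite -{1}B_sym -trmx_mul mulmxBl yB -scalemxAl.
    rewrite -[X in _ *: (_ *m X)]B_sym -trmx_mul Bx.
    by rewrite trmx0 scaler0 subrr trmx0.
  move=> /(congr1 trmx); rewrite trmxK trmx0 => /eqP.
  rewrite subr_eq0 => /eqP ->.
  exact: scalemx_sub.
have k2 : (0 < \rank (kermx B))%N.
  rewrite lt0n mxrank_eq0; apply/eqP=> K0; apply: x0.
  have : (x^T <= kermx B)%MS.
    by apply/sub_kermxP; rewrite -{1}B_sym -trmx_mul Bx trmx0.
  by rewrite K0 submx0 => /eqP h; apply: trmx_inj; rewrite h trmx0.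
have := rank_leq_row B; lia.
Qed.
End GramType.

(** Bounded pairings leave finitely many roots, hence a semidefinite invariant form. The threshold 4
    is that of [mul_le0_or_gt4]. *)
Lemma indefinite_unbounded n (A : 'M[int]_n) :
  cartan_matrix A -> indecomposable A -> indefinite_type A ->
  exists c y i, is_root A c y /\ 4 < `|pairing c (scoroot i)|.
Proof.
move=> cA iA [nf na]; apply: contrapT => h.
have bd c y i : is_root A c y -> `|pairing c (scoroot i)| <= 4.
  move=> hc; rewrite leNgt; apply/negP=> hp; apply: h; by exists c, y, i.
have [m [V hV]] := finite_roots_gram cA bd.
by case: (gram_finite_or_affine cA iA hV).
Qed.

(** * Homogeneous components and invariant forms *)

Section Homogeneous.
Variable n : nat.
Implicit Types (f g : {mpoly rat[n]}) (w : 'M[rat]_n).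

Lemma euler d f : f \is d.-homog -> \sum_i 'X_i * f^`M(i) = d%:R *: f.
Proof.
move=> /dhomogP hf.
have mono m : \sum_i 'X_i * 'X_[m]^`M(i) =
    (mdeg m)%:R *: 'X_[m] :> {mpoly rat[n]}.
  rewrite mdegE natr_sum scaler_suml; apply: eq_bigr => i _.
  rewrite mderivX -scalerAr.
  have [->|mi] := eqVneq (m i) 0%N; first by rewrite !scale0r.
  rewrite -mpolyXD addmC submK //; apply/mnm_lepP=> j; rewrite mnm1E.
  by case: eqP => [<-|//]; rewrite lt0n.
rewrite {1}(mpolyE f) [in RHS](mpolyE f).
under eq_bigr do rewrite raddf_sum mulr_sumr /=.
rewrite exchange_big /= scaler_sumr !big_seq; apply: eq_bigr => m /hf md.
rewrite scalerA mulrC -scalerA -md -mono scaler_sumr; apply: eq_bigr => i _.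
by rewrite mderivZ scalerAr.
Qed.

Lemma lin_homog (l : 'rV[rat]_n) : lin l \is 1.-homog.
Proof.
by apply: rpred_sum => j _; apply: rpredZ; rewrite dhomogX /= mdeg1.
Qed.

Lemma poly_act_homog w d f : f \is d.-homog -> poly_act w f \is d.-homog.
Proof.
move=> /dhomogP hf; rewrite (mpolyE f) raddf_sum /= big_seq.
apply: rpred_sum => m /hf <-.
rewrite linearZ /=; apply: rpredZ; rewrite mpolyXE_id rmorph_prod mdegE /=.
apply: (big_ind2 (fun g k => g \is k.-homog)) => [|g1 k1 g2 k2 h1 h2|i _].
- exact: dhomog1.
- exact: dhomogM.
- rewrite rmorphXn /= poly_actX -[X in X.-homog]mul1n.
  by apply/dhomogMn/lin_homog.
Qed.

Lemma poly_act_pihomog w d f :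
  poly_act w (pihomog mdeg d f) = pihomog mdeg d (poly_act w f).
Proof.
(* The maximum puts [d] among the summed degrees even when it exceeds the degree of [f]. *)
have := pihomog_partitionE (mf := mdeg) (p := f)
  (k := maxn (msize f) d.+1) (leq_maxl _ _).
set k := maxn _ _ => hf; have dk : (d < k)%N by rewrite leq_maxr.
have -> : poly_act w f = \sum_(e < k) poly_act w (pihomog mdeg e f).
  by rewrite [in LHS]hf (raddf_sum (poly_act w)).
have hh e : poly_act w (pihomog mdeg e f) \is e.-homog.
  by apply: poly_act_homog; exact: pihomogP.
rewrite (raddf_sum (pihomog mdeg d)) /= (bigD1 (Ordinal dk)) //=.
rewrite (pihomog_dE (hh d)) big1 ?addr0 // => e ed.
apply: (pihomog_ne0 (d := e)) (hh e).
by apply: contra ed => /eqP ed; apply/eqP/val_inj.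
Qed.

Lemma pihomog_inv_ring (A : 'M[int]_n) d f :
  inv_ring A f -> inv_ring A (pihomog mdeg d f).
Proof. by move=> hf w hw; rewrite poly_act_pihomog hf. Qed.

Lemma pihomog_msize d f : (d < msize f)%N ->
  (msize (pihomog mdeg d f) <= msize f)%N.
Proof.
move=> df; apply: leq_trans df; rewrite msizeE; apply/bigmax_leqP_seq => m hm _.
by move/dhomogP: (pihomogP mdeg d f) => ->.
Qed.

Lemma dhomog0_const f : f \is 0.-homog -> f = (f@_0%MM)%:MP.
Proof.
move=> hf; apply: msize1_polyC; rewrite msizeE; apply/bigmax_leqP_seq => m hm _.
by move/dhomogP: hf => ->.
Qed.

End Homogeneous.

(** * Invariant symmetric forms and symmetrizability *)

Section Forms.
Variables (n : nat) (A : 'M[int]_n).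
Hypothesis cA : cartan_matrix A.

Lemma toQ_delta i : toQ (scoroot i) = delta_mx i 0 :> 'cV[rat]_n.
Proof. exact: map_delta_mx. Qed.

Lemma toQ_sroot i j : toQ (sroot A i) 0 j = (A j i)%:~R.
Proof. by rewrite !mxE. Qed.

Lemma bilin_delta (B : 'M[rat]_n) i j :
  bilin B (delta_mx i 0) (delta_mx j 0) = B i j.
Proof. by rewrite /bilin trmx_delta -rowE -colE !mxE. Qed.

Lemma bilin_srefl (B : 'M[rat]_n) x y a :
  bilin B (- x) (y - a *: x) = a * bilin B x x - bilin B x y.
Proof.
rewrite /bilin.
have -> : (- x)^T *m B *m (y - a *: x) = a *: (x^T *m B *m x) - x^T *m B *m y.
  by rewrite linearN /= !mulNmx mulmxBr -scalemxAr opprB.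
by rewrite [LHS]mxE [X in X + _]mxE [X in _ + X]mxE.
Qed.

Lemma bilinC (B : 'M[rat]_n) x y : B^T = B -> bilin B x y = bilin B y x.
Proof.
move=> sB; rewrite /bilin -[RHS]trace_mx11 -mxtrace_tr trace_mx11.
by rewrite !trmx_mul trmxK sB mulmxA.
Qed.

(** Invariance under the i-th reflection, tested on the coroots i and j, is the displayed equation.
    Conversely the equation gives [B *m e] as B_ii / 2 times the transposed i-th root, so the
    generators preserve B. *)
Lemma invariant_form_iff (B : 'M[rat]_n) : invariant_symmetric_form A B <->
  B^T = B /\ forall i j, 2 * B i j = (A j i)%:~R * B i i.
Proof.
split=> [[symB invB]|[symB relB]].
  split; first by apply/matrixP=> i j; rewrite mxE -!bilin_delta symB.
  move=> i j; have := invB _ (weyl_reflection _ A i)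
    (delta_mx i 0) (delta_mx j 0).
  have ws : toQ (srefl_simple A i) *m toQ (srefl_simple A i) = 1%:M.
    by rewrite -map_mxM srefl_simpleK // map_mx1.
  have wi : invmx (toQ (srefl_simple A i)) = toQ (srefl_simple A i).
    have [wu _] := mulmx1_unit ws.
    by rewrite -[RHS](mulKmx wu) ws mulmx1.
  rewrite /coroot_act reflection_srefl wi map_srefl toQ_delta !mul_srefl_cV.
  rewrite !pairing_delta !toQ_sroot bilin_delta; case: cA => -> _ _.
  by rewrite subr_scaler2 bilin_srefl !bilin_delta => h; lra.
have hw w : weyl A w -> w^T *m B *m w = B.
  elim=> [|i|w1 w2 _ h1 _ h2|u _ hu].
  - by rewrite trmx1 mul1mx mulmx1.
  - rewrite reflection_srefl map_srefl toQ_delta; set a := toQ _.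
    set e := delta_mx _ _.
    have Be : B *m e = (B i i / 2) *: a^T.
      rewrite -colE; apply/colP=> j; rewrite !mxE -{1}symB mxE.
      by have := relB i j; move=> h; lra.
    have eB : e^T *m B = (B i i / 2) *: a.
      by apply: trmx_inj; rewrite trmx_mul trmxK symB Be linearZ.
    pose N := a^T *m a; set t := B i i / 2 in Be eB.
    have h1 : (e *m a)^T *m B = t *: N.
      by rewrite trmx_mul -mulmxA eB -scalemxAr.
    have h2 : B *m (e *m a) = t *: N by rewrite mulmxA Be -scalemxAl.
    have ae : a *m e = 2%:M.
      rewrite [a *m e]mx11_scalar; congr (_%:M).
      by rewrite -[LHS]/(pairing a e) pairing_delta toQ_sroot; case: cA => ->.
    have h3 : N *m (e *m a) = 2 *: N.
      by rewrite -mulmxA (mulmxA a) ae mul_scalar_mx -scalemxAr.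
    have -> : (srefl a e)^T = 1%:M - (e *m a)^T.
      by rewrite /srefl linearB /= trmx1.
    rewrite /srefl mulmxBl mul1mx h1 mulmxBr mulmx1 mulmxBl h2.
    rewrite -scalemxAl h3; move: N {h1 h2 h3} => N.
    by apply/matrixP=> k l; rewrite !mxE; ring.
  - by rewrite -[RHS]h2 -[in RHS]h1 trmx_mul !mulmxA.
  - have [uu|uu] := boolP (u \in unitmx); last by rewrite invmx_out.
    by rewrite -{1}hu !mulmxA -trmx_mul mulmxV // trmx1 mul1mx mulmxK.
split=> [x y|w ww x y]; first exact: bilinC.
have := hw _ (weylV ww); rewrite /bilin /coroot_act trmx_mul => e.
by rewrite -[in RHS]e !mulmxA.
Qed.
End Forms.

Section FormPoly.
Variables (n : nat) (A : 'M[int]_n).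
Hypothesis cA : cartan_matrix A.

Lemma ev_form_poly (B : 'M[rat]_n) x : ev (form_poly B) x = bilin B x x.
Proof.
rewrite /ev /form_poly raddf_sum /bilin mxE /=.
under [RHS]eq_bigr => k _ do rewrite mxE mulr_suml.
rewrite exchange_big /=; apply: eq_bigr => i _.
rewrite raddf_sum /=; apply: eq_bigr => j _.
by rewrite mevalZ mevalM !mevalXU mxE; ring.
Qed.

Lemma form_poly_homog (B : 'M[rat]_n) : form_poly B \is 2.-homog.
Proof.
apply: rpred_sum => i _; apply: rpred_sum => j _; apply: rpredZ.
by rewrite -mpolyXD dhomogX /= mdegD !mdeg1.
Qed.

Lemma form_polyZ c (B : 'M[rat]_n) : form_poly (c *: B) = c *: form_poly B.
Proof.
rewrite /form_poly scaler_sumr; apply: eq_bigr => i _; rewrite scaler_sumr.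
by apply: eq_bigr => j _; rewrite mxE scalerA.
Qed.

Lemma form_poly_neq0 (B : 'M[rat]_n) i : B i i != 0 -> form_poly B != 0.
Proof.
apply: contra_neq => B0; have := ev_form_poly B (delta_mx i 0).
by rewrite B0 /ev meval0 bilin_delta => <-.
Qed.

Lemma bilin_polar (B : 'M[rat]_n) x y : B^T = B ->
  2 * bilin B x y = bilin B (x + y) (x + y) - bilin B x x - bilin B y y.
Proof.
move=> sB; have bDl u v z : bilin B (u + v) z = bilin B u z + bilin B v z.
  by rewrite /bilin linearD /= !mulmxDl mxE.
have bDr u v z : bilin B z (u + v) = bilin B z u + bilin B z v.
  by rewrite /bilin mulmxDr mxE.
have -> : bilin B (x + y) (x + y) =
    bilin B x x + bilin B x y + (bilin B y x + bilin B y y).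
  by rewrite bDl !bDr.
by rewrite (bilinC y x sB); ring.
Qed.

Lemma inv_form_poly (B : 'M[rat]_n) : B^T = B ->
  inv_ring A (form_poly B) <-> invariant_symmetric_form A B.
Proof.
move=> sB; split=> [h|[sym h] w ww].
  split=> [x y|w ww x y]; first exact: bilinC.
  have q z : bilin B (coroot_act w z) (coroot_act w z) = bilin B z z.
    by rewrite -!ev_form_poly /coroot_act -ev_poly_act h //; apply: weylV.
  apply: (mulfI (_ : 2 != 0 :> rat)) => //.
  by rewrite !bilin_polar // -mulmxDr -/(coroot_act w (x + y)) !q.
apply/eqP; rewrite -subr_eq0; apply/eqP/ev_eq0=> x.
rewrite /ev mevalB; apply/eqP; rewrite subr_eq0; apply/eqP.
rewrite -[LHS]/(ev _ _) -[RHS]/(ev _ _) ev_poly_act !ev_form_poly.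
by have := h _ (weylV ww) x x; rewrite /coroot_act invmxK => ->.
Qed.

Lemma form_symmetrizable (B : 'M[rat]_n) :
  invariant_symmetric_form A B -> (forall i, B i i != 0) -> symmetrizable A.
Proof.
move=> /(invariant_form_iff cA)[sB hB] B0.
(* The form gives [A i j] = 2 B_ij / B_jj; extracting B_ii from row i leaves a symmetric matrix. *)
exists (diag_mx (\row_i B i i)).
exists (\matrix_(i, j) (2 * B i j / (B i i * B j j))); split.
- exact: diag_mx_is_diag.
- rewrite unitmxE det_diag unitfE; apply/prodf_neq0=> i _; by rewrite mxE.
- by apply/matrixP=> i j; rewrite !mxE -{1}sB mxE [B j j * _]mulrC.
- apply/matrixP=> i j; rewrite mul_diag_mx !mxE.
  have := hB j i; rewrite -{1}sB mxE => h; rewrite h; field; by rewrite !B0.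
Qed.

Lemma symmetrizable_form : symmetrizable A ->
  exists B : 'M[rat]_n, invariant_symmetric_form A B /\ forall i, B i i != 0.
Proof.
move=> [D [C [/is_diag_mxP dD uD sC e]]].
have aE i j : (A i j)%:~R = D i i * C i j.
  have := congr1 (fun M : 'M_n => M i j) e.
  rewrite !mxE (bigD1 i) //= big1 ?addr0 //.
  by move=> k ki; rewrite dD ?mul0r // eq_sym.
have D2 i : D i i * C i i = 2 by rewrite -aE; case: cA => -> _ _.
(* From A = DC the form is DCD, and the diagonal of [A] gives [D i i * C i i] = 2. *)
exists (\matrix_(i, j) (D i i * C i j * D j j)); split=> [|i]; last first.
  rewrite mxE D2 mulf_neq0 //; apply: contra_eq_neq (D2 i) => ->.
  by rewrite mul0r.
have Cs i j : C i j = C j i by rewrite -{1}sC mxE.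
apply/(invariant_form_iff cA); split=> [|i j].
  by apply/matrixP=> i j; rewrite !mxE Cs; ring.
by rewrite !mxE aE (D2 i) (Cs j i); ring.
Qed.

Hypothesis iA : indecomposable A.

(** A zero on the diagonal spreads along edges: B_ii = 0 forces B_ij = 0, and then [A i j] B_jj =
    0. *)
Lemma invariant_form_eq0 (B : 'M[rat]_n) i0 :
  invariant_symmetric_form A B -> B i0 i0 = 0 -> B = 0.
Proof.
move=> /(invariant_form_iff cA)[sB hB] Bi0.
pose S := [set i | B i i == 0].
have S0 : S != set0 by apply/set0Pn; exists i0; rewrite inE Bi0.
have [ST|ST] := eqVneq S setT.
  apply/matrixP=> i j; have := in_setT i; rewrite -ST inE => /eqP Bi.
  by have := hB i j; rewrite Bi mulr0 mxE => h; lra.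
have [i [j [iS jS Aij]]] := indecomposable_connected cA iA S0 ST.
rewrite !inE in iS jS; have := hB j i; rewrite -{1}sB mxE.
have -> : B i j = 0 by have := hB i j; rewrite (eqP iS) mulr0 => h; lra.
rewrite mulr0 => /esym/eqP; rewrite mulf_eq0 intr_eq0.
by rewrite (negPf Aij) (negPf jS).
Qed.

Lemma invariant_form_unique (B C : 'M[rat]_n) i0 : B i0 i0 != 0 ->
  invariant_symmetric_form A B -> invariant_symmetric_form A C ->
  exists c, C = c *: B.
Proof.
move=> B0 /(invariant_form_iff cA)[sB hB] /(invariant_form_iff cA)[sC hC].
exists (C i0 i0 / B i0 i0); set c := _ / _.
apply/eqP; rewrite -subr_eq0; apply/eqP.
apply: (@invariant_form_eq0 _ i0); last by rewrite !mxE /c divfK // subrr.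
apply/(invariant_form_iff cA); split; first by rewrite linearB linearZ /= sB sC.
move=> i j; rewrite !mxE; have := hB i j; have := hC i j.
move: (_%:~R) => a h1 h2.
by rewrite mulrBr mulrBr h1 (mulrCA _ c) h2; ring.
Qed.

(** * Factoring a homogeneous invariant *)

Section Factor.
Variables (d : nat) (f : {mpoly rat[n]}).
Hypotheses (d0 : (0 < d)%N) (fd : f \is d.-homog) (f0 : f != 0).
Hypothesis finv : inv_ring A f.

Lemma srefl_simple_coroot i :
  toQ (srefl_simple A i) *m delta_mx i 0 = - delta_mx i 0 :> 'cV[rat]_n.
Proof.
rewrite map_srefl toQ_delta mul_srefl_cV pairing_delta toQ_sroot.
by case: cA => -> _ _; rewrite subr_scaler2.
Qed.

Lemma poly_act_simple_dirder i x :
  poly_act (toQ (srefl_simple A i)) (dirder x f) =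
  dirder (toQ (srefl_simple A i) *m x) f.
Proof.
apply: poly_act_dirder; last by move/inv_ringP: finv; apply.
by rewrite -map_mxM srefl_simpleK // map_mx1.
Qed.

(** Reflections reduce this to simple coroots. If D_j f = 0, reflecting in k gives [A j k] D_k f =
    0, so all partial derivatives vanish by connectedness, against the positive degree. *)
Lemma dirder_root_neq0 b x : is_root A b x -> dirder (toQ x) f != 0.
Proof.
elim=> [i|i b' x' _ ih]; last first.
  apply: contra ih => /eqP h; apply/eqP.
  have := poly_act_simple_dirder i (toQ (srefl_simple A i *m x')).
  by rewrite h raddf0 map_mxM mulmxA -map_mxM srefl_simpleK // map_mx1 mul1mx.
rewrite toQ_delta dirder_delta; apply/eqP=> fi.
pose S := [set j | f^`M(j) == 0].
have S0 : S != set0 by apply/set0Pn; exists i; rewrite inE fi.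
have [ST|ST] := eqVneq S setT.
  case/negP: f0; have fc : f = (f@_0%MM)%:MP.
    by apply: mderiv_eq0_const => j; have := in_setT j; rewrite -ST inE => /eqP.
  rewrite fc (dhomog_nemf_coeff fd) ?mpolyC0 // /= mdeg0.
  by rewrite eq_sym -lt0n.
have [j [k [jS kS Ajk]]] := indecomposable_connected cA iA S0 ST.
rewrite !inE in jS kS; case/negP: kS.
have := poly_act_simple_dirder k (delta_mx j 0).
rewrite dirder_delta (eqP jS) raddf0 map_srefl toQ_delta mul_srefl_cV.
rewrite pairing_delta toQ_sroot dirderDl dirderNl dirderZl !dirder_delta.
rewrite (eqP jS) sub0r => /esym/eqP.
by rewrite oppr_eq0 -mul_mpolyC mulf_eq0 mpolyC_eq0 intr_eq0
  (negPf Ajk).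
Qed.

Hypothesis ndA : indefinite_type A.

(** For one hyperbolic index i0, the derivative along its coroot changes sign under its reflection,
    so its root divides it with quotient [h]; [rel] carries the same [h] to every index. *)
Lemma gradient_factor : exists h (c : 'I_n -> rat),
  (forall k, c k != 0) /\
  forall k, f^`M(k) = c k *: (lin (toQ (sroot A k)) * h).
Proof.
have [b [y [i0 [hb hi]]]] := indefinite_unbounded cA iA ndA.
have hyp := root_unbounded_hyperbolic cA finv dirder_root_neq0 hb hi.
have rl := simple_roots_rel cA finv dirder_root_neq0
  (indecomposable_connected cA iA) hyp.
have [h hh] : exists h, f^`M(i0) = lin (toQ (sroot A i0)) * h.
  apply: (@lin_dvd_anti _ _ (toQ (scoroot i0))).
  rewrite -map_srefl -dirder_delta.
  by rewrite poly_act_simple_dirder srefl_simple_coroot dirderNl.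
exists h.
have ex k : exists c : rat,
    c != 0 /\ f^`M(k) = c *: (lin (toQ (sroot A k)) * h).
  have [a a0] := rl k; rewrite !toQ_delta !dirder_delta hh => e.
  exists a^-1; split; first by rewrite invr_eq0.
  have l0 : lin (toQ (sroot A i0)) != 0.
    exact: (lin_root_neq0 cA (is_root_simple A _)).
  apply: (mulfI l0); rewrite -scalerAr mulrCA e scalerA mulVf //.
  by rewrite scale1r.
have [c hc] := fin_all_exists ex; exists c; split=> k; by case: (hc k).
Qed.

Lemma invariant_factor : exists h (B : 'M[rat]_n),
  [/\ invariant_symmetric_form A B, forall i, B i i != 0,
      inv_ring A h & f = h * form_poly B].
Proof.
have [h [c [c0 hc]]] := gradient_factor.
have dn0 : (d%:R : rat) != 0 by rewrite pnatr_eq0 -lt0n.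
(* Both the i-th derivative of [f] and the i-th root change sign under the i-th reflection, so their
   quotient is fixed. *)
have hinv : inv_ring A h.
  apply/inv_ringP => i.
  have := poly_act_simple_dirder i (delta_mx i 0).
  rewrite srefl_simple_coroot dirderNl dirder_delta hc.
  rewrite linearZ /= rmorphM /= poly_act_lin.
  have -> : toQ (sroot A i) *m toQ (srefl_simple A i) = - toQ (sroot A i).
    rewrite map_srefl mul_rV_srefl toQ_delta pairing_delta toQ_sroot.
    by case: cA => -> _ _; rewrite subr_scaler2.
  rewrite linN mulNr scalerN => /oppr_inj /(scalerI (c0 i)); apply: mulfI.
  exact: (lin_root_neq0 cA (is_root_simple A _)).
(* The symmetrized coefficients of the quadratic form in Euler's formula, divided by d; its diagonal
   entries are 2 c_i / d. *)
pose B : 'M[rat]_n := \matrix_(k, l)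
  ((2 * d%:R)^-1 * (c k * (A l k)%:~R + c l * (A k l)%:~R)).
have fE : f = h * form_poly B.
  pose T : {mpoly rat[n]} := \sum_k c k *: ('X_k * lin (toQ (sroot A k))).
  have T1 : \sum_k \sum_l (c k * (A l k)%:~R) *: ('X_k * 'X_l) = T.
    apply: eq_bigr => k _; rewrite /lin mulr_sumr scaler_sumr.
    apply: eq_bigr => l _.
    by rewrite toQ_sroot -scalerAr scalerA.
  have T2 : \sum_k \sum_l (c l * (A k l)%:~R) *: ('X_k * 'X_l) = T.
    rewrite -T1 exchange_big; apply: eq_bigr => k _; apply: eq_bigr => l _.
    by rewrite mulrC ['X_l * _]mulrC mulrC.
  have -> : form_poly B = d%:R^-1 *: T.
    have -> : d%:R^-1 *: T = (2 * d%:R)^-1 *: (T + T).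
      rewrite -mulr2n -scaler_nat scalerA; congr (_ *: _); by field.
    rewrite -{1}T1 -T2 -big_split scaler_sumr /=; apply: eq_bigr => k _.
    rewrite -big_split scaler_sumr /=; apply: eq_bigr => l _.
    by rewrite -scalerDl scalerA mxE.
  rewrite -scalerAr; apply: (scalerI dn0).
  rewrite scalerA divff // scale1r -(euler fd) mulr_sumr; apply: eq_bigr => k _.
  by rewrite hc -!scalerAr [h * _]mulrC mulrA.
have sB : B^T = B by apply/matrixP=> k l; rewrite !mxE addrC.
have h0 : h != 0 by apply: contra_neq f0 => h0; rewrite fE h0 mul0r.
exists h, B; split=> //; last first.
  move=> i; rewrite mxE; case: cA => -> _ _.
  by rewrite -mulrDr mulf_neq0 ?invr_eq0 ?mulf_neq0 //.
apply/inv_form_poly => // w ww; apply: (mulfI h0).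
by rewrite -fE -{1}(hinv w ww) -rmorphM /= -fE finv.
Qed.
End Factor.
End FormPoly.

(** * The ring of invariants *)

Lemma inv_ring_horner_alg n (A : 'M[int]_n) psi p :
  inv_ring A psi -> inv_ring A (horner_alg psi p).
Proof.
move=> hpsi w ww; elim/poly_ind: p => [|p c ih]; first by rewrite !raddf0.
rewrite rmorphD rmorphM /= horner_algX horner_algC rmorphD rmorphM /=.
by rewrite ih hpsi // linearZ /= rmorph1.
Qed.

(** The cofactor [h] of a component is not known to be homogeneous, so the induction on size covers
    all invariants and splits each into components. *)
Lemma inv_ring_poly_form n (A : 'M[int]_n) (B : 'M[rat]_n) f :
  cartan_matrix A -> indecomposable A -> indefinite_type A ->
  invariant_symmetric_form A B -> (forall i, B i i != 0) ->
  inv_ring A f -> exists p, f = horner_alg (form_poly B) p.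
Proof.
move=> cA iA ndA iB B0; have [k] := ubnP (msize f).
elim: k f => // k ih f; rewrite ltnS => fk finv.
have comp (e : 'I_(msize f)) :
    exists p, pihomog mdeg e f = horner_alg (form_poly B) p.
  have ge := pihomogP mdeg e f; have ginv := pihomog_inv_ring e finv.
  have gk := leq_trans (pihomog_msize (ltn_ord e)) fk.
  move: (pihomog mdeg e f) ge ginv gk => g ge ginv gk.
  have [->|g0] := eqVneq g 0; first by exists 0; rewrite raddf0.
  have [e0|e0] := posnP e.
    rewrite e0 in ge; rewrite (dhomog0_const ge); exists (g@_0%MM)%:P.
    by rewrite horner_algC alg_mpolyC.
  have [h [C [iC C0 hinv gE]]] := invariant_factor cA iA e0 ge g0 ginv ndA.
  have [b [y [i0 _]]] := indefinite_unbounded cA iA ndA.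
  have [c cE] := invariant_form_unique cA iA (B0 i0) iB iC.
  have q0 := form_poly_neq0 (C0 i0).
  have h0 : h != 0 by apply: contra_neq g0 => h0; rewrite gE h0 mul0r.
  have hk : (msize h < k)%N.
    apply: leq_trans gk; rewrite gE msizeM //.
    have := dhomog_uniq q0 (form_poly_homog C)
      (dhomog_msize (form_poly_homog C)).
    move: h0; rewrite -msize_poly_eq0.
    by move: (msize h) (msize (form_poly C)) => u v; lia.
  have [p pE] := ih h hk hinv; exists (c%:P * (p * 'X)).
  rewrite gE pE cE form_polyZ !rmorphM /= horner_algC horner_algX.
  by rewrite mulr_algl scalerAr.
have [p pE] := fin_all_exists comp; exists (\sum_e p e).
rewrite raddf_sum /= [LHS](pihomog_partitionE (mf := mdeg) (k := msize f)) //.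
by apply: eq_bigr => e _; rewrite pE.
Qed.

(** A non-zero component of positive degree would yield an invariant form with non-zero diagonal,
    which symmetrizes [A]. *)
Lemma inv_ring_const n (A : 'M[int]_n) f :
  cartan_matrix A -> indecomposable A -> indefinite_type A ->
  ~ symmetrizable A -> inv_ring A f -> exists c : rat, f = c%:MP.
Proof.
move=> cA iA ndA nsA finv.
rewrite [f](pihomog_partitionE (mf := mdeg) (k := (msize f).+1)) //.
rewrite big_ord_recl big1 ?addr0 => [|e _].
  by exists ((pihomog mdeg 0 f)@_0%MM); apply/dhomog0_const/pihomogP.
apply/eqP/negPn/negP=> g0; apply: nsA.
have [h [B [iB B0 _ _]]] := invariant_factor cA iA (isT : (0 < lift ord0 e)%N)
  (pihomogP mdeg _ f) g0 (pihomog_inv_ring _ finv) ndA.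
exact: form_symmetrizable iB B0.
Qed.

Theorem mainTheorem1 (n : nat) (A : 'M[int]_n) :
  cartan_matrix A -> indecomposable A -> indefinite_type A ->
  (symmetrizable A ->
     exists (psi : {mpoly rat[n]}) (B : 'M[rat]_n),
       [/\ psi != 0,
           inv_ring_deg A 2 psi,
           invariant_symmetric_form A B /\ psi = form_poly B,
           (forall B' : 'M[rat]_n, invariant_symmetric_form A B' ->
              exists c : rat, B' = c *: B) &
           (forall f : {mpoly rat[n]},
              inv_ring A f <-> exists p : {poly rat}, f = horner_alg psi p)]) /\
  (~ symmetrizable A ->
     forall f : {mpoly rat[n]}, inv_ring A f <-> exists c : rat, f = c%:MP).
Proof.
move=> cA iA ndA; split=> [sA|nsA f]; last first.
  split=> [|[c ->] w _]; last exact: poly_actC.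
  exact: inv_ring_const.
(* This supplies an index, needed to see that the form polynomial is non-zero. *)
have [_ [_ [i0 _]]] := indefinite_unbounded cA iA ndA.
have [B [iB B0]] := symmetrizable_form cA sA.
have Binv : inv_ring A (form_poly B).
  by apply/inv_form_poly => //; case/(invariant_form_iff cA): iB.
exists (form_poly B), B; split=> //.
- exact: form_poly_neq0 (B0 i0).
- by split=> //; exact: form_poly_homog.
- by move=> C; apply: (invariant_form_unique cA iA (B0 i0)).
- move=> f; split=> [|[p ->]]; first exact: inv_ring_poly_form.
  exact: inv_ring_horner_alg.
Qed.
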